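(* Let $\alpha\in(0,2)$ and suppose that for some $\alpha_0\in(0,\alpha/2)$, $$\limsup_{|x|\to\infty}\bigg[\Big(\sup_{|z|\ge|x|}e^{-V(z)}\Big)|x|^{d+\alpha-\alpha_0}\bigg]=0.$$ Then there exists a constant $C_2>0$ such that for all $f\in C_b^\infty(\mathbb R^d)$, $$\int\big(f(x)-\mu_V(f)\big)^2\,\omega(x)\,\mu_V(dx)\le C_2 D_{\alpha,V}(f,f),\qquad \omega(x):=\frac{e^{V(x)}}{(1+|x|)^{d+\alpha}}.$$ Moreover, $\omega$ is optimal in the following sense: if $\omega^*$ is a positive function on $\mathbb R^d$ with $\liminf_{|x|\to\infty}\omega^*(x)/\omega(x)=\infty$, then there is no constant $C>0$ such that $\int(f-\mu_V(f))^2\omega^*\,d\mu_V\le C D_{\alpha,V}(f,f)$ for all $f\in C_b^\infty(\mathbb R^d)$.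
   Context: Let $d\ge1$. $V:\mathbb R^d\to\mathbb R$ is a locally bounded measurable function such that $e^{-V}$ is bounded and $\int e^{-V(x)}dx<\infty$; $\mu_V(dx)=\frac{e^{-V(x)}}{\int e^{-V(y)}dy}dx$, and $\mu_V(f)=\int f\,d\mu_V$. $C_b^\infty(\mathbb R^d)$ is the set of smooth functions on $\mathbb R^d$ that are bounded together with all their derivatives. For $\alpha\in(0,2)$, $$D_{\alpha,V}(f,f):=\iint\frac{(f(y)-f(x))^2}{|y-x|^{d+\alpha}}\,dy\,\mu_V(dx).$$ *)

(* Defs.v *)
From HB Require Import structures.
From mathcomp Require Import all_boot all_order all_algebra.
From mathcomp Require Import all_classical all_reals all_analysis.
Set Implicit Arguments. Unset Strict Implicit. Unset Printing Implicit Defensive.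
Import Order.TTheory GRing.Theory Num.Theory.
Import numFieldNormedType.Exports.
Local Open Scope classical_set_scope.
Local Open Scope ring_scope.

Section Defs.
Variable R : realType.

Definition enorm (d : nat) (x : 'rV[R]_d) : R :=
  Num.sqrt (\sum_(i < d) x ord0 i ^+ 2).

Definition rvcons (n : nat) (t : R) (x : 'rV[R]_n) : 'rV[R]_n.+1 :=
  \row_(i < n.+1) match unlift ord0 i with None => t | Some j => x ord0 j end.

(* iterated one-dimensional Lebesgue integrals: for Borel measurable
   nonnegative F this is (Tonelli) the Lebesgue integral over R^n *)
Fixpoint iint (n : nat) : ('rV[R]_n -> \bar R) -> \bar R :=
  match n with
  | 0 => fun F => F 0
  | n.+1 => fun F =>
      (\int[@lebesgue_measure R]_t iint (fun x : 'rV[R]_n => F (rvcons t x)))%E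
  end.

Definition borel_Rd (d : nat) (A : set 'rV[R]_d) : Prop :=
  (@open 'rV[R]_d).-sigma.-measurable A.

Definition borel_fun (d : nat) (g : 'rV[R]_d -> R) : Prop :=
  forall B : set R, measurable B -> borel_Rd (g @^-1` B).

Definition ZV (d : nat) (V : 'rV[R]_d -> R) : R :=
  fine (iint (fun x => (expR (- V x))%:E)).

Definition muV_int (d : nat) (V : 'rV[R]_d -> R) (F : 'rV[R]_d -> \bar R) : \bar R :=
  (iint (fun x => F x * (expR (- V x))%:E) * ((ZV V)^-1)%:E)%E.

Definition muV (d : nat) (V : 'rV[R]_d -> R) (f : 'rV[R]_d -> R) : R :=
  fine (muV_int V (fun x => (Num.max (f x) 0)%:E))
  - fine (muV_int V (fun x => (Num.max (- f x) 0)%:E)).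

Definition DaV (d : nat) (alpha : R) (V : 'rV[R]_d -> R) (f : 'rV[R]_d -> R) : \bar R :=
  muV_int V (fun x => iint (fun y =>
     ((f y - f x) ^+ 2 / (enorm (y - x)) `^ (d%:R + alpha))%:E)).

Definition pderiv (d : nat) (i : 'I_d) (g : 'rV[R]_d -> R) : 'rV[R]_d -> R :=
  fun x => derive g x (delta_mx ord0 i).

Fixpoint dern (d : nat) (s : seq 'I_d) (g : 'rV[R]_d -> R) : 'rV[R]_d -> R :=
  match s with
  | [::] => g
  | i :: s' => pderiv i (dern s' g)
  end.

(* C_b^infty(R^d): all partial derivatives of all orders exist everywhere
   and are bounded (this implies they are continuous) *)
Definition Cbinf (d : nat) (f : 'rV[R]_d -> R) : Prop :=
  forall s : seq 'I_d,
    (forall (i : 'I_d) (x : 'rV[R]_d), derivable (dern s f) x (delta_mx ord0 i)) /\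
    (exists M : R, forall x, `|dern s f x| <= M).

Definition omega (d : nat) (alpha : R) (V : 'rV[R]_d -> R) (x : 'rV[R]_d) : R :=
  expR (V x) / (1 + enorm x) `^ (d%:R + alpha).

Definition admissible_V (d : nat) (V : 'rV[R]_d -> R) : Prop :=
  borel_fun V /\
  (forall r : R, exists M : R, forall x, enorm x <= r -> `|V x| <= M) /\
  (exists M : R, forall x, expR (- V x) <= M) /\
  (iint (fun x => (expR (- V x))%:E) < +oo)%E.

End Defs.

(* Main.v *)
Require Import Defs.
From HB Require Import structures.
From mathcomp Require Import all_boot all_order all_algebra.
From mathcomp Require Import all_classical all_reals all_analysis.
From mathcomp Require Import measurable_realfun ring lra.
Set Implicit Arguments. Unset Strict Implicit. Unset Printing Implicit Defensive.
Import Order.TTheory GRing.Theory Num.Theory.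
Import numFieldNormedType.Exports.
Local Open Scope classical_set_scope.
Local Open Scope ring_scope.

(** Write w(y) = (1+|y|)^-(d+alpha), so that omega e^-V = w, and b = alpha - alpha0.

    Inequality.  For x in the unit cube, |y-x| <= d(1+|y|) and e^-V(x) is
    bounded below, hence D(f,f) dominates the integral over x in the cube of
    G(x) = int (f(y)-f(x))^2 w(y) dy.  Conversely int (f - mu f)^2 w <= C G(x)
    for every x, because |f(x) - mu f| <= (1/Z) int |f(y)-f(x)| e^-V(y) dy and,
    by Cauchy-Schwarz, its square is at most C G(x) int e^-2V / w, where
    e^-2V / w = O((1+|y|)^-(d+alpha-2 alpha0)) is integrable as
    2 alpha0 < alpha.  Integrating over the cube gives the claim.

    Optimality.  Take f_n(x) = cos(x_j/n).  Then D(f_n,f_n) = O(n^-alpha) and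
    1 - mu f_n = O(n^-b), both because the integral of
    min(1, |y-x|^2/n^2) / |y-x|^(d+b) is O(n^-b), which follows from cutting space
    into dyadic shells around x.  On a cube of side n at distance about n from
    the origin f_n <= 0, so the left-hand side is at least of order
    n^-alpha inf_{|x|>=n} (omega^*/omega). *)

Notation borelRV R d := (g_sigma_algebraType (@open 'rV[R]_d)).

(** * Packing a measure with a proof of sigma-finiteness *)

Section sigma_finite_copy.
Context (dT : measure_display) (T : measurableType dT) (R : realType).
Variables (m : {measure set T -> \bar R}) (fm : sigma_finite [set: T] m).

(** An alias to carry the structure built from [fm]: a measure constructed inside a proof can then
    be handed to Tonelli's theorem. *)
Definition sigma_finite_copy : set T -> \bar R := m.
HB.instance Definition _ := Measure.copy sigma_finite_copy m.
HB.instance Definition _ := Measure_isSigmaFinite.Build _ _ _ sigma_finite_copy fm.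
Definition sigma_finite_pack : {sigma_finite_measure set T -> \bar R} := sigma_finite_copy.

End sigma_finite_copy.

(** * Lebesgue measure on R^d and its Borel sigma-algebra *)

Section lebesgue_measure_Rd.
Variable R : realType.

Lemma continuous_borel d (f : 'rV[R]_d -> R) :
  continuous f -> measurable_fun setT (f : borelRV R d -> R).
Proof.
move=> /continuousP cf; apply: (measurability _ (RGenOpens.measurableE R)).
move=> _ [_ [a [b ->] <-]]; rewrite setTI; apply: sub_sigma_algebra.
exact/cf/interval_open.
Qed.

Lemma measurable_coord d (i : 'I_d) :
  measurable_fun setT (fun x : borelRV R d => x ord0 i).
Proof. by apply: continuous_borel; exact: (@coord_continuous R 1 d ord0 i). Qed.

(** Measurability is asked of the coordinates of [phi], so that [phi] may also be the difference map
    on a product of two Borel spaces. *)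
Lemma measurable_enorm_comp d dX (X : measurableType dX) (phi : X -> 'rV[R]_d) :
  (forall i, measurable_fun setT (fun w => phi w ord0 i)) ->
  measurable_fun setT (fun w => enorm (phi w)).
Proof.
move=> h.
have h1 : measurable_fun setT (fun w => \sum_(i < d) phi w ord0 i ^+ 2).
  by apply: measurable_sum => i; exact: measurable_funX.
have h' : measurable_fun setT (Num.sqrt : R -> R).
  by apply: continuous_measurable_fun; exact: sqrt_continuous.
exact: (measurableT_comp h' h1).
Qed.

Lemma measurable_enorm d : measurable_fun setT (@enorm R d : borelRV R d -> R).
Proof.
exact: (@measurable_enorm_comp d _ (borelRV R d) (fun x => x) (@measurable_coord d)).
Qed.

Lemma rvcons0 n t (x : 'rV[R]_n) : rvcons t x ord0 ord0 = t.
Proof. by rewrite mxE unlift_none. Qed.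

Lemma rvconsS n t (x : 'rV[R]_n) (i : 'I_n) :
  rvcons t x ord0 (lift ord0 i) = x ord0 i.
Proof. by rewrite mxE liftK. Qed.

(* Sup-norm balls are boxes: this is what makes [rvcons] measurable for the
   product sigma-algebra, and not only continuous. *)
Lemma open_ball_cover d (U : set 'rV[R]_d) (x : 'rV[R]_d) : open U -> U x ->
  exists (q : 'rV[rat]_d) (k : nat),
    ball (map_mx ratr q : 'rV[R]_d) k.+1%:R^-1 x /\
    ball (map_mx ratr q : 'rV[R]_d) k.+1%:R^-1 `<=` U.
Proof.
move=> oU Ux.
have /nbhs_ballP[e /= e0 eU] : nbhs x U by exact: open_nbhs_nbhs.
have [k /andP[_ ke]] : exists k : nat, 0 < (k.+1%:R^-1 : R) < e / 2.
  exists (Num.truncn (e / 2)^-1); rewrite invr_gt0 ltr0Sn /=.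
  rewrite invf_plt ?posrE// ?divr_gt0// truncnS_gt//.
set r : R := k.+1%:R^-1 in ke *.
have r0 : 0 < r by rewrite invr_gt0.
have H i : exists q : rat, `|ratr q - x ord0 i| < r.
  have [q] := @rat_in_itvoo R (x ord0 i - r) (x ord0 i + r) ltac:(lra).
  by rewrite in_itv/= => /andP[q1 q2]; exists q; rewrite ltr_norml; apply/andP; split; lra.
pose q : 'rV[rat]_d := \row_i xget 0 [set q | `|ratr q - x ord0 i| < r].
have qP i : `|ratr (q ord0 i) - x ord0 i| < r.
  rewrite mxE; have [q0 hq] := H i.
  exact: (@xgetPex _ 0 [set q | `|ratr q - x ord0 i| < r] (ex_intro _ q0 hq)).
exists q, k; split=> [|y By].
  by split=> // i j; rewrite (ord1 i) mxE; exact: qP.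
apply: eU; split=> // i j; rewrite (ord1 i) /ball/=.
have := By.2 ord0 j; rewrite [X in ball X]mxE -/r /ball/= => h2; have := qP j.
change (`|ratr (q ord0 j) - x ord0 j| < r -> `|x ord0 j - y ord0 j| < e) => h1.
by rewrite (le_lt_trans (ler_distD (ratr (q ord0 j)) _ _))// (distrC (x ord0 j)); lra.
Qed.

Lemma measurable_rvcons n : measurable_fun setT
  (fun z : measurableTypeR R * borelRV R n => rvcons z.1 z.2 : borelRV R n.+1).
Proof.
apply: (@measurability _ _ (measurableTypeR R * borelRV R n)%type (borelRV R n.+1) setT _ (@open 'rV[R]_n.+1)) => //.
move=> _ [U oU <-]; rewrite setTI.
(* Countably many rational boxes exhaust [U]: [A k] decodes [k] as a box and is empty unless that
   box lies in [U]. *)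
pose B (p : 'rV[rat]_n.+1 * nat) : set 'rV[R]_n.+1 := ball (map_mx ratr p.1 : 'rV[R]_n.+1) p.2.+1%:R^-1.
pose A (k : nat) : set 'rV[R]_n.+1 :=
  if unpickle k is Some p then (if `[< B p `<=` U >] then B p else set0) else set0.
have -> : U = \bigcup_k A k.
  apply/seteqP; split => [x Ux|x [k _]].
    have [q [k [h1 h2]]] := open_ball_cover oU Ux.
    exists (pickle (q, k)) => //; rewrite /A pickleK.
    by case: asboolP => // /(_ h2).
  by rewrite /A; case: unpickle => // p; case: asboolP => // h; exact: h.
rewrite preimage_bigcup; apply: bigcupT_measurable => k; rewrite /A.
case: unpickle => [p|]; last by rewrite preimage_set0.
case: asboolP => _; last by rewrite preimage_set0.
pose q : 'rV[R]_n := \row_j ratr (p.1 ord0 (lift ord0 j)).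
(* A sup-norm ball splits off its first coordinate, so its preimage is a measurable rectangle. *)
have -> : (fun z : measurableTypeR R * borelRV R n => rvcons z.1 z.2) @^-1` B p =
    ball (ratr (p.1 ord0 ord0) : R) p.2.+1%:R^-1 `*` ball q p.2.+1%:R^-1.
  apply/seteqP; split => [[t x] /= [r0 h]|[t x] /= [h1 [r0 h2]]].
    split; first by have := h ord0 ord0; rewrite rvcons0 mxE.
    by split=> // i j; have := h ord0 (lift ord0 j); rewrite rvconsS !mxE (ord1 i).
  split=> // i j; rewrite (ord1 i) mxE; case: (unliftP ord0 j) => [j' ->|->].
    by rewrite rvconsS; have := h2 ord0 j'; rewrite mxE.
  by rewrite rvcons0.
apply: measurableX.
  by apply: open_measurable; exact: ball_open.
by apply: sub_sigma_algebra; exact: ball_open.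
Qed.

Definition cube {d} (c : 'rV[R]_d) (s : R) : set 'rV[R]_d :=
  [set x | forall i, c ord0 i <= x ord0 i <= c ord0 i + s].

Lemma measurable_cube d (c : 'rV[R]_d) s : measurable (cube c s : set (borelRV R d)).
Proof.
have -> : cube c s = \bigcap_(i in [set: 'I_d]) ((fun x : borelRV R d => x ord0 i) @^-1` `[c ord0 i, c ord0 i + s]).
  apply/seteqP; split => [x h i _ /=|x h i]; first by rewrite in_itv/=; exact: h.
  by have := h i I; rewrite /= in_itv.
apply: fin_bigcap_measurable => // i _; rewrite -[X in measurable X]setTI.
by apply: measurable_coord => //; exact: measurable_itv.
Qed.

(* [m] is Lebesgue measure on R^d, with [iint] as its integral.  It is only
   characterized, since its construction by pushing forward iterated products
   along [rvcons] plays no role afterwards. *)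
Definition lebesgue_like d (m : {sigma_finite_measure set (borelRV R d) -> \bar R}) :=
  (forall F : borelRV R d -> \bar R, measurable_fun setT F -> (forall x, 0 <= F x)%E ->
     iint F = \int[m]_x F x)%E /\
  (forall c s, 0 <= s -> m (cube c s) = (s ^+ d)%:E).

(** The cubes [-k, k]^d have finite measure and exhaust the space. *)
Lemma cubeT_sigma_finite d (m : {measure set (borelRV R d) -> \bar R}) :
  (forall c s, 0 <= s -> m (cube c s) = (s ^+ d)%:E) -> sigma_finite [set: borelRV R d] m.
Proof.
move=> h; exists (fun k => cube (const_mx (- k%:R)) k.*2%:R); last first.
  by move=> k; split; [exact: measurable_cube|rewrite h// ltry].
apply/seteqP; split=> // x _.
pose M := \sum_(i < d) `|x ord0 i|.
exists (Num.truncn M).+1 => // i; rewrite mxE.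
have hM : `|x ord0 i| < (Num.truncn M).+1%:R.
  rewrite (le_lt_trans _ (truncnS_gt M))// /M (bigD1 i)//= lerDl sumr_ge0//.
move: hM; rewrite ltr_norml => /andP[h1 h2].
rewrite -addnn natrD; apply/andP; split; lra.
Qed.

(** Induction along the recursion of [iint]: a point mass in dimension 0, then the image under
    [rvcons] of the product with Lebesgue measure on the line, where Tonelli's theorem produces the
    outer integral. *)
Lemma lebesgue_likeP d : exists m, @lebesgue_like d m.
Proof.
elim: d => [|n [m [m1 m2]]].
  pose m : {measure set (borelRV R 0) -> \bar R} := dirac (0 : borelRV R 0).
  have cm c s : 0 <= s -> m (cube c s) = (s ^+ 0)%:E.
    by move=> s0; rewrite expr0 /m /= /dirac indicE mem_set// => -[].
  exists (sigma_finite_pack (cubeT_sigma_finite cm)); split => //.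
  move=> F mF F0 /=; rewrite -[RHS]/(\int[m]_x F x)%E.
  by rewrite integral_dirac// diracT mul1e.
pose rv := (fun z : measurableTypeR R * borelRV R n => rvcons z.1 z.2 : borelRV R n.+1).
pose leb : {sigma_finite_measure set (measurableTypeR R) -> \bar R} := @lebesgue_measure R.
pose p : {measure set (measurableTypeR R * borelRV R n) -> \bar R} := (leb \x m)%E.
pose m' : {measure set (borelRV R n.+1) -> \bar R} :=
  measure_function_pushforward__canonical__measure_function_Measure p (@measurable_rvcons n).
have cm c s : 0 <= s -> m' (cube c s) = (s ^+ n.+1)%:E.
  move=> s0; rewrite /m' /= /pushforward.
  have -> : (fun z : measurableTypeR R * borelRV R n => rvcons z.1 z.2) @^-1` cube c s =
    `[c ord0 ord0, c ord0 ord0 + s]%classic `*` cube (\row_j c ord0 (lift ord0 j)) s.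
    apply/seteqP; split => [[t x] /= h|[t x] /= [h1 h2] i].
      split; first by have := h ord0; rewrite rvcons0 in_itv.
      by move=> j; have := h (lift ord0 j); rewrite rvconsS !mxE.
    case: (unliftP ord0 i) => [j ->|->].
      by rewrite rvconsS; have := h2 j; rewrite mxE.
    by rewrite rvcons0; move: h1; rewrite in_itv.
  pose I : set (measurableTypeR R) := `[c ord0 ord0, c ord0 ord0 + s]%classic.
  transitivity (leb I * m (cube (\row_j c ord0 (lift ord0 j)) s))%E.
    by apply: product_measure1E; [exact: measurable_itv|exact: measurable_cube].
  have -> : leb I = s%:E.
    rewrite -[LHS]/(@lebesgue_measure R `[c ord0 ord0, c ord0 ord0 + s]%classic).
    rewrite lebesgue_measure_itv/= lte_fin ltrDl.
    case: ltP => s1; first by rewrite -EFinB addrAC subrr add0r.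
    by congr EFin; apply/eqP; rewrite eq_le s0.
  by rewrite m2// -EFinM exprS.
exists (sigma_finite_pack (cubeT_sigma_finite cm)); split => //.
move=> F mF F0 /=; rewrite -[RHS]/(\int[m']_x F x)%E.
rewrite ge0_integral_pushforward//=; last exact: measurable_rvcons.
have mFr : measurable_fun setT (F \o rv) by exact: measurableT_comp mF (@measurable_rvcons n).
rewrite preimage_setT fubini_tonelli1//.
apply: eq_integral => t _; rewrite m1//.
exact: (measurableT_comp mFr (pair1_measurable t)).
Qed.
End lebesgue_measure_Rd.

(** * Dyadic shells and the integral of the truncated jump kernel *)

Section shells.
Variable R : realType.

Lemma geometric_sum_le (q : R) n : 0 <= q < 1 -> \sum_(k < n) q ^+ k <= (1 - q)^-1.
Proof.
move=> /andP[q0 q1]; rewrite -[leRHS]mul1r ler_pdivlMr ?subr_gt0//.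
have -> : (\sum_(k < n) q ^+ k) * (1 - q) = 1 - q ^+ n.
  by rewrite mulrC -opprB mulNr -subrX1 opprB.
by rewrite gerBl exprn_ge0.
Qed.

(** At each point [g] is below some [h k], hence below their sum, which integrates term by term to a
    geometric series. The shells may overlap. *)
Lemma integral_le_geometric dT (T : measurableType dT) (mu : {measure set T -> \bar R})
  (g : T -> \bar R) (h : nat -> T -> \bar R) (K q : R) :
  measurable_fun setT g -> (forall x, 0 <= g x)%E ->
  (forall k, measurable_fun setT (h k)) -> (forall k x, 0 <= h k x)%E ->
  (forall x, exists k, (g x <= h k x)%E) ->
  (forall k, (\int[mu]_x h k x <= (K * q ^+ k)%:E)%E) ->
  0 <= q < 1 -> 0 <= K ->
  (\int[mu]_x g x <= (K / (1 - q))%:E)%E.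
Proof.
move=> mg g0 mh h0 gh hK q01 K0.
apply: (@le_trans _ _ (\int[mu]_x (\sum_(k <oo) h k x))%E).
  apply: ge0_le_integral => //.
  - exact: (ge0_emeasurable_sum (fun k x _ _ => h0 k x) (fun k _ => mh k)).
  - move=> x _; have [k] := gh x; move/le_trans; apply.
    apply: (@le_trans _ _ (\sum_(0 <= i < k.+1) h i x)%E).
      by rewrite big_nat_recr//= leeDr// sume_ge0.
    exact: nneseries_lim_ge.
rewrite integral_nneseries//; apply: lime_le.
  by apply: is_cvg_nneseries => n _ _; exact: integral_ge0.
apply: nearW => n /=; rewrite big_mkord.
apply: (@le_trans _ _ (\sum_(k < n) (K * q ^+ k)%:E)%E).
  by apply: lee_sum => k _.
by rewrite sumEFin lee_fin -mulr_sumr ler_wpM2l// geometric_sum_le.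
Qed.

Lemma dyadic (r : R) : 1 <= r -> exists k, (2 ^+ k <= r < 2 ^+ k.+1).
Proof.
move=> r1.
have ex : exists n : nat, r < 2 ^+ n.
  exists (Num.truncn r).+1; rewrite (lt_trans (truncnS_gt r))//.
  by rewrite -natrX ltr_nat ltn_expl.
(* The least exponent is positive because 1 <= r; its predecessor is the witness. *)
case: (ex_minnP ex) => -[|k] hk kmin; first by move: hk; rewrite expr0 ltNge r1.
exists k; rewrite hk andbT leNgt; apply/negP => /kmin.
by rewrite ltnn.
Qed.

Section enorm.
Variable d : nat.
Implicit Types x : 'rV[R]_d.

Lemma enorm_ge0 x : 0 <= enorm x. Proof. exact: sqrtr_ge0. Qed.

Lemma coord_le_enorm x i : `|x ord0 i| <= enorm x.
Proof.
rewrite -sqrtr_sqr /enorm ler_wsqrtr// (bigD1 i)//= lerDl.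
by apply: sumr_ge0 => j _; exact: sqr_ge0.
Qed.

Lemma sum_sqr_le (F : 'I_d -> R) :
  (forall i, 0 <= F i) -> \sum_i F i ^+ 2 <= (\sum_i F i) ^+ 2.
Proof.
move=> F0; rewrite expr2 mulr_suml; apply: ler_sum => i _.
by rewrite expr2 ler_wpM2l// (bigD1 i)//= lerDl sumr_ge0.
Qed.

Lemma enorm_le_sum x : enorm x <= \sum_i `|x ord0 i|.
Proof.
have s0 : 0 <= \sum_i `|x ord0 i| by exact: sumr_ge0.
rewrite -[leRHS]ger0_norm// -sqrtr_sqr ler_wsqrtr//.
rewrite (le_trans _ (sum_sqr_le _))//.
by under [leRHS]eq_bigr do rewrite real_normK ?num_real//.
Qed.

Lemma measurable_enorm_subr x :
  measurable_fun setT (fun y : borelRV R d => enorm (y - x)).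
Proof.
apply: (@measurable_enorm_comp R d _ (borelRV R d)) => i.
rewrite [X in measurable_fun _ X](_ : _ = fun y : borelRV R d => y ord0 i - x ord0 i).
  by apply: measurable_funB => //; exact: measurable_coord.
by apply/funext => y; rewrite !mxE.
Qed.

Lemma measurable_enorm_sub :
  measurable_fun setT (fun z : borelRV R d * borelRV R d => enorm (z.2 - z.1)).
Proof.
apply: (@measurable_enorm_comp R d _ (borelRV R d * borelRV R d)%type) => i.
rewrite [X in measurable_fun _ X](_ : _ =
  fun z : borelRV R d * borelRV R d => z.2 ord0 i - z.1 ord0 i).
  apply: measurable_funB.
    exact: (measurableT_comp (@measurable_coord R d i) measurable_snd).
  exact: (measurableT_comp (@measurable_coord R d i) measurable_fst).
by apply/funext => y; rewrite !mxE.
Qed.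

(** [lebesgue_like] gives the measure of cubes, so Euclidean balls around [x] are enclosed in
    cubes. *)
Lemma sub_cube x y rho : enorm (y - x) <= rho ->
  cube (x - const_mx rho) (2 * rho) y.
Proof.
move=> h i; rewrite !mxE.
have := le_trans (coord_le_enorm (y - x) i) h; rewrite !mxE ler_norml => /andP[h1 h2].
by apply/andP; split; lra.
Qed.

End enorm.

(** Radial profile shared by the two estimates for cos(x_j/n): with b = alpha it controls the
    energy, with b = alpha - alpha0 the mean. *)
Definition jump d (b n r : R) : R := Num.min 1 ((r / n) ^+ 2) / r `^ (d%:R + b).

Lemma jump_ge0 d b n r : 0 <= jump d b n r.
Proof. by rewrite /jump divr_ge0 ?powR_ge0// le_min ler01 sqr_ge0. Qed.

Lemma measurable_inv_powR (s : R) : measurable_fun setT (fun r : R => (r `^ s)^-1).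
Proof.
have -> : (fun r : R => (r `^ s)^-1) = fun r => r `^ (- s).
  by apply/funext => r; rewrite powRN.
exact: measurable_powR.
Qed.

Lemma measurable_jump d b n : measurable_fun setT (jump d b n).
Proof.
apply: measurable_funM; last exact: measurable_inv_powR.
apply: measurable_minr => //.
by apply: measurable_funX; apply: measurable_funM.
Qed.

Lemma ler_powR_inv (s x y : R) : 0 <= s -> 0 < x -> x <= y -> (y `^ s)^-1 <= (x `^ s)^-1.
Proof.
move=> s0 x0 xy; have y0 : 0 < y by exact: lt_le_trans xy.
rewrite lef_pV2 ?posrE ?powR_gt0// ge0_ler_powR// nnegrE ltW//.
Qed.

Lemma powR_natD d b (t : R) : 0 < t -> t `^ (d%:R + b) = t ^+ d * t `^ b.
Proof.
by move=> t0; rewrite powRD ?powR_mulrn ?ltW// (gt_eqF t0) implybT.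
Qed.

Lemma powRX (t b : R) k : 0 <= t -> (t ^+ k) `^ b = (t `^ b) ^+ k.
Proof.
by move=> t0; rewrite -(powR_mulrn k t0) -(powR_mulrn k (powR_ge0 t b)) -!powRrM mulrC.
Qed.

Lemma ltr_powR (a x y : R) : 1 < a -> x < y -> a `^ x < a `^ y.
Proof.
move=> a1 xy; rewrite /powR gt_eqF ?(lt_trans ltr01 a1)//.
by rewrite ltr_expR ltr_pM2r// ln_gt0.
Qed.

(** The left alternative is the shell n 2^k <= r < n 2^(k+1), where the minimum is at most 1; the
    right one is n / 2^(k+1) < r <= n / 2^k, where it is at most (r/n)^2 <= 4^-k. The power of r is
    taken at the inner radius. *)
Lemma jump_shells d b n r : 0 < b -> 0 < n -> 0 <= r ->
  exists k,
   (r <= n * 2 ^+ k.+1 /\ jump d b n r <= ((n * 2 ^+ k) `^ (d%:R + b))^-1) \/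
   (r <= n / 2 ^+ k /\
     jump d b n r <= (4 ^+ k)^-1 * ((n / 2 ^+ k.+1) `^ (d%:R + b))^-1).
Proof.
move=> b0 n0; rewrite le_eqVlt => /predU1P[<-|r0].
  (* At r = 0 the minimum vanishes, so the kernel is 0 whatever the inverse power of 0 is. *)
  exists 0%N; left; split; first by rewrite mulr_ge0// ltW.
  rewrite /jump mul0r expr0n/= (_ : Num.min 1 0 = 0) ?mul0r ?invr_ge0 ?powR_ge0//.
  by apply/min_idPr.
have s0 : 0 <= d%:R + b by rewrite addr_ge0// ltW.
have j1 : Num.min 1 ((r / n) ^+ 2) <= 1 by rewrite ge_min lexx.
have j2 : Num.min 1 ((r / n) ^+ 2) <= (r / n) ^+ 2 by rewrite ge_min lexx orbT.
have [nr|rn] := leP n r.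
  have [k /andP[k1 k2]] := @dyadic (r / n) ltac:(by rewrite ler_pdivlMr// mul1r).
  exists k; left; split; first by rewrite -ler_pdivrMl// mulrC ltW.
  rewrite /jump -[leRHS]mul1r ler_pM ?invr_ge0 ?powR_ge0//.
    by rewrite le_min ler01 sqr_ge0.
  rewrite ler_powR_inv// ?mulr_gt0 ?exprn_gt0//.
  by rewrite -ler_pdivlMl// mulrC.
have [k /andP[k1 k2]] := @dyadic (n / r) ltac:(by rewrite ler_pdivlMr// mul1r ltW).
exists k; right; have k0 : 0 < 2 ^+ k :> R by rewrite exprn_gt0.
have rk : r <= n / 2 ^+ k by rewrite ler_pdivlMr// mulrC -ler_pdivlMr.
split=> //.
rewrite /jump ler_pM ?invr_ge0 ?powR_ge0//.
- by rewrite le_min ler01 sqr_ge0.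
- have -> : (4 ^+ k)^-1 = ((2 ^+ k)^-1) ^+ 2 :> R.
    by rewrite exprVn -exprM mulnC exprM; congr (_ ^+ k)^-1; ring.
  rewrite (le_trans j2)//.
  rewrite lerXn2r ?nnegrE ?divr_ge0 ?invr_ge0 ?(ltW n0) ?(ltW r0) ?(ltW k0)//.
  by rewrite ler_pdivrMr// mulrC.
- rewrite ler_powR_inv// ?divr_gt0 ?exprn_gt0//.
  rewrite ler_pdivrMr ?exprn_gt0// mulrC -ler_pdivrMr// ltW//.
Qed.

(** Shell volume times kernel bound decays like 2^(-bk) outwards and (2^b/4)^k inwards: b > 0 gives
    convergence at infinity, b < 2 convergence at [x]. Each shell contributes a multiple of n^-b,
    uniformly in [x]. *)
Lemma jump_integral d (m : {sigma_finite_measure set (borelRV R d) -> \bar R}) b :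
  lebesgue_like m -> 0 < b < 2 ->
  exists2 C, 0 < C & forall x n, 0 < n ->
    (\int[m]_y (jump d b n (enorm (y - x)))%:E <= (C / n `^ b)%:E)%E.
Proof.
move=> [_ mc] /andP[b0 b2].
pose c := 2 `^ b : R.
have c1 : 1 < c by rewrite /c -[X in X < _](powRr0 2) ltr_powR// ltr1n.
have c4 : c < 4.
  have -> : (4 : R) = 2 `^ 2 by rewrite powR_mulrn// -natrX.
  by rewrite ltr_powR// ltr1n.
have c0 : 0 < c by lra.
(* The larger of the outer and inner ratios, so that one geometric series bounds both families. *)
pose q := Num.max c^-1 (c / 4).
have q01 : 0 <= q < 1.
  rewrite le_max invr_ge0 (ltW c0)/= gt_max invf_lt1// c1/=; lra.
exists (4 ^+ d * (1 + c) / (1 - q)).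
  by rewrite divr_gt0// ?mulr_gt0 ?exprn_gt0//; lra.
move=> x n n0; have nb0 : 0 < n `^ b by exact: powR_gt0.
have -> : 4 ^+ d * (1 + c) / (1 - q) / n `^ b =
  (4 ^+ d * (1 + c) / n `^ b) / (1 - q) by rewrite -!mulrA [_^-1 * _]mulrC.
pose Q rho := cube (x - const_mx rho) (2 * rho) : set (borelRV R d).
have mQ rho : measurable (Q rho) by exact: measurable_cube.
pose ck k := ((n * 2 ^+ k) `^ (d%:R + b))^-1.
pose ck' k := (4 ^+ k)^-1 * ((n / 2 ^+ k.+1) `^ (d%:R + b))^-1.
have ck0 k : 0 <= ck k by rewrite invr_ge0 powR_ge0.
have ck'0 k : 0 <= ck' k by rewrite mulr_ge0// invr_ge0 ?powR_ge0// exprn_ge0.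
pose h1 k (y : borelRV R d) := ((ck k)%:E * (\1_(Q (n * 2 ^+ k.+1)) y)%:E)%E.
pose h2 k (y : borelRV R d) := ((ck' k)%:E * (\1_(Q (n / 2 ^+ k)) y)%:E)%E.
have mI A : measurable A -> measurable_fun setT (fun y : borelRV R d => (\1_A y)%:E : \bar R).
  by move=> mA; apply/measurable_EFinP; exact: measurable_indic.
have int1 a A : 0 <= a -> measurable A ->
    (\int[m]_y (a%:E * (\1_A y)%:E) = a%:E * m A)%E.
  move=> a0 mA; rewrite ge0_integralZl ?lee_fin//; last exact: mI.
  by rewrite integral_indic// setIT.
have mh1 k : measurable_fun setT (h1 k) by apply: measurable_funeM; exact: mI.
have mh2 k : measurable_fun setT (h2 k) by apply: measurable_funeM; exact: mI.
have h10 k y : (0 <= h1 k y)%E by rewrite mule_ge0 ?lee_fin.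
have h20 k y : (0 <= h2 k y)%E by rewrite mule_ge0 ?lee_fin.
apply: (@integral_le_geometric _ _ _ _ (fun k y => h1 k y + h2 k y)%E) => //.
- apply/measurable_EFinP.
  exact: (measurableT_comp (@measurable_jump d b n) (measurable_enorm_subr x)).
- by move=> y; rewrite lee_fin jump_ge0.
- by move=> k; exact: emeasurable_funD.
- by move=> k y; rewrite adde_ge0.
- move=> y; have [k [[r1 r2]|[r1 r2]]] := jump_shells d b0 n0 (enorm_ge0 (y - x)).
    exists k; apply: le_trans (leeDl _ (h20 _ _)).
    by rewrite /h1 indicE mem_set ?mule1 ?lee_fin//; exact: sub_cube.
  exists k; apply: le_trans (leeDr _ (h10 _ _)).
  by rewrite /h2 indicE mem_set ?mule1 ?lee_fin//; exact: sub_cube.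
- move=> k; rewrite ge0_integralD// /h1 /h2.
  rewrite !int1// !mc ?mulr_ge0 ?exprn_ge0 ?invr_ge0 ?(ltW n0)//.
  rewrite -!EFinM -EFinD lee_fin.
  have k0 : 0 < 2 ^+ k :> R by rewrite exprn_gt0.
  (* The enclosing cube has side four times the inner radius of its shell, whence 4^d; the d-th
     powers of the radius cancel. *)
  have -> : ck k * (2 * (n * 2 ^+ k.+1)) ^+ d = 4 ^+ d / n `^ b * (c^-1) ^+ k.
    rewrite /ck powR_natD ?mulr_gt0//.
    have -> : 2 * (n * 2 ^+ k.+1) = 4 * (n * 2 ^+ k) by rewrite exprS; ring.
    rewrite [(4 * _) ^+ d]exprMn (powRM b (ltW n0) (ltW k0)) powRX// -/c exprVn.
    have : (n * 2 ^+ k) ^+ d != 0 by rewrite expf_neq0// gt_eqF// mulr_gt0.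
    have : c ^+ k != 0 by rewrite expf_neq0// gt_eqF.
    have : n `^ b != 0 by rewrite gt_eqF.
    move: ((n * 2 ^+ k) ^+ d) (c ^+ k) (n `^ b) (4 ^+ d) => X Y Z W X0 Y0 Z0.
    by field; rewrite X0 Y0 Z0.
  have -> : ck' k * (2 * (n / 2 ^+ k)) ^+ d = 4 ^+ d * c / n `^ b * (c / 4) ^+ k.
    rewrite /ck' powR_natD ?divr_gt0// ?exprn_gt0//.
    have -> : 2 * (n / 2 ^+ k) = 4 * (n / 2 ^+ k.+1).
      by rewrite exprS; move: (2 ^+ k) k0 => t t0; field; rewrite gt_eqF.
    have -> : (n / 2 ^+ k.+1) `^ b = n `^ b / (c * c ^+ k).
      rewrite powRM ?invr_ge0 ?exprn_ge0 ?(ltW n0)//.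
      rewrite -(powR_inv1 (exprn_ge0 _ _))// -powRrM mulN1r powRN powRX// -/c.
      by rewrite [c ^+ k.+1]exprS.
    rewrite [(4 * _) ^+ d]exprMn [(c / 4) ^+ k]expr_div_n.
    have : (n / 2 ^+ k.+1) ^+ d != 0.
      by rewrite expf_neq0// gt_eqF// divr_gt0// exprn_gt0.
    have : c ^+ k != 0 by rewrite expf_neq0// gt_eqF.
    have : n `^ b != 0 by rewrite gt_eqF.
    have : (4 : R) ^+ k != 0 by rewrite expf_neq0// gt_eqF.
    move: ((n / 2 ^+ k.+1) ^+ d) (c ^+ k) (n `^ b) (4 ^+ d) (4 ^+ k) => X Y Z W V V0 Z0 Y0 X0.
    by field; rewrite V0 X0 Y0 Z0 gt_eqF.
  have q1 : c^-1 ^+ k <= q ^+ k.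
    by rewrite lerXn2r ?nnegrE ?invr_ge0 ?(ltW c0)// ?le_max ?lexx ?invr_ge0 ?(ltW c0)//.
  have q2 : (c / 4) ^+ k <= q ^+ k.
    rewrite lerXn2r ?nnegrE ?divr_ge0 ?(ltW c0)// ?le_max ?lexx ?invr_ge0 ?(ltW c0)// ?orbT//.
  have -> : 4 ^+ d * (1 + c) / n `^ b * q ^+ k = 4 ^+ d / n `^ b * q ^+ k +
     4 ^+ d * c / n `^ b * q ^+ k by ring.
  by rewrite lerD// ler_wpM2l// ?divr_ge0 ?mulr_ge0 ?exprn_ge0 ?(ltW c0) ?(ltW nb0).
- by rewrite divr_ge0 ?mulr_ge0 ?exprn_ge0 ?(ltW nb0)//; lra.
Qed.

End shells.

(** * Integrals and means with respect to mu_V *)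

Section mean.
Variable R : realType.

Lemma borel_fun_measurable d (g : 'rV[R]_d -> R) :
  borel_fun g -> measurable_fun setT (g : borelRV R d -> R).
Proof. by move=> hg _ B mB; rewrite setTI; exact: hg. Qed.

(** On the unit ball the weight is at most 1 and the enclosing cube has volume 2^d; outside, the
    weight is below the jump kernel with n = 1, whose minimum equals 1 there. *)
Lemma weight_integral d (m : {sigma_finite_measure set (borelRV R d) -> \bar R}) b :
  lebesgue_like m -> 0 < b < 2 ->
  exists2 W, 0 < W &
    (\int[m]_x (((1 + enorm x) `^ (d%:R + b))^-1)%:E <= W%:E)%E.
Proof.
move=> Lm b02; have [C C0 hC] := jump_integral Lm b02.
have [b0 b2] := andP b02; have [_ mc] := Lm.
have s0 : 0 <= d%:R + b by rewrite addr_ge0// ltW.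
exists (2 ^+ d + C); first by rewrite addr_gt0// exprn_gt0.
pose Q := cube (0 - const_mx 1) (2 * 1) : set (borelRV R d).
have mQ : measurable Q by exact: measurable_cube.
have me := @measurable_enorm R d.
have mI : measurable_fun setT (fun y : borelRV R d => (\1_Q y)%:E : \bar R).
  by apply/measurable_EFinP; exact: measurable_indic.
have mj : measurable_fun setT (fun y : borelRV R d => (jump d b 1 (enorm y))%:E).
  by apply/measurable_EFinP; exact: (measurableT_comp (@measurable_jump R d b 1) me).
apply: (@le_trans _ _ (\int[m]_x ((\1_Q x)%:E + (jump d b 1 (enorm x))%:E))%E).
  apply: ge0_le_integral => //.
  - by move=> x _; rewrite lee_fin invr_ge0 powR_ge0.
  - apply/measurable_EFinP.
    apply: (measurableT_comp (@measurable_inv_powR R (d%:R + b))).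
    by apply: measurable_funD.
  - exact: emeasurable_funD.
  - move=> x _; rewrite -EFinD lee_fin.
    have [x1|x1] := leP (enorm x) 1.
      rewrite indicE mem_set; last by apply: sub_cube; rewrite subr0.
      rewrite -[leLHS]addr0 lerD ?jump_ge0//.
      rewrite (@le_trans _ _ (1 `^ (d%:R + b))^-1)//; last by rewrite powR1 invr1.
      by rewrite ler_powR_inv// lerDl enorm_ge0.
    rewrite -[leLHS]add0r lerD// /jump (_ : Num.min _ _ = 1); last first.
      by apply/min_idPl; rewrite divr1 exprn_ege1// ltW.
    by rewrite mul1r ler_powR_inv// ?lerDr// (lt_trans ltr01).
rewrite ge0_integralD//; last by move=> x _; rewrite lee_fin jump_ge0.
rewrite EFinD leeD//.
  have -> : (\int[m]_x (\1_Q x)%:E = m Q)%E by rewrite integral_indic// setIT.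
  by rewrite mc ?mulr1.
have := hC 0 1 ltr01; rewrite powR1 invr1 mulr1; apply: le_trans.
by rewrite le_eqVlt; apply/orP; left; apply/eqP; apply: eq_integral => y _; rewrite subr0.
Qed.

Section weighted.
Variables (d : nat) (m : {sigma_finite_measure set (borelRV R d) -> \bar R}).
Hypothesis Lm : lebesgue_like m.
Variable V : 'rV[R]_d -> R.
Hypothesis mV : measurable_fun setT (V : borelRV R d -> R).
Hypothesis Vfin : (iint (fun x => (expR (- V x))%:E) < +oo)%E.

Let u (x : borelRV R d) := expR (- V x).

Lemma measurable_density : measurable_fun setT u.
Proof. by apply: measurableT_comp => //; exact: measurableT_comp. Qed.
Let mu := measurable_density.

Lemma integral_density : (\int[m]_x (u x)%:E = (ZV V)%:E)%E.
Proof.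
rewrite /ZV (Lm.1 (fun x => (u x)%:E)); last 2 first.
- exact/measurable_EFinP.
- by move=> x; rewrite lee_fin expR_ge0.
rewrite fineK// ge0_fin_numE; last by apply: integral_ge0 => x _; rewrite lee_fin expR_ge0.
rewrite -Lm.1 => //; first exact/measurable_EFinP.
by move=> x; rewrite lee_fin expR_ge0.
Qed.

(** The unit cube has measure one, so it alone contributes at least [c]. *)
Lemma ZV_gt0 c : 0 < c -> (forall x, cube 0 1 x -> c <= u x) -> 0 < ZV V.
Proof.
move=> c0 hc; rewrite -lte_fin -integral_density.
have mQ : measurable (cube 0 1 : set (borelRV R d)) by exact: measurable_cube.
apply: (@lt_le_trans _ _ (\int[m]_(x in cube 0 1) c%:E)%E).
  have -> : (\int[m]_(x in cube 0 1) c%:E = c%:E * m (cube 0 1))%E by rewrite integral_cst.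
  by rewrite Lm.2// expr1n mule1 lte_fin.
apply: (@le_trans _ _ (\int[m]_(x in cube 0 1) (u x)%:E)%E).
  apply: ge0_le_integral => //.
  - by move=> x _; rewrite lee_fin ltW.
  - by apply: measurable_funTS; apply/measurable_EFinP.
apply: ge0_subset_integral => //; first exact/measurable_EFinP.
by move=> x _; rewrite lee_fin expR_ge0.
Qed.

Lemma muV_intE (F : borelRV R d -> R) : measurable_fun setT F -> (forall x, 0 <= F x) ->
  muV_int V (fun x => (F x)%:E) = (\int[m]_x (F x * u x)%:E * ((ZV V)^-1)%:E)%E.
Proof.
move=> mF F0; rewrite /muV_int (Lm.1 (fun x => (F x)%:E * (u x)%:E))%E.
- by [].
- by apply: emeasurable_funM; exact/measurable_EFinP.
- by move=> x; rewrite mule_ge0 ?lee_fin ?expR_ge0.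
Qed.

Hypothesis Z0 : 0 < ZV V.
Variable f : borelRV R d -> R.
Hypothesis mf : measurable_fun setT f.
Variable Mf : R.
Hypothesis fM : forall x, `|f x| <= Mf.

Let mfu : measurable_fun setT (fun x => f x * u x).
Proof. exact: measurable_funM. Qed.

Let iu : m.-integrable setT (fun x => (u x)%:E).
Proof.
apply/integrableP; split; first exact/measurable_EFinP.
under eq_integral do rewrite gee0_abs ?lee_fin ?expR_ge0//.
by rewrite integral_density ltry.
Qed.

Let ifu : m.-integrable setT (fun x => (f x * u x)%:E).
Proof.
apply: (@le_integrable _ _ _ m _ measurableT _ (fun x => (Mf%:E * (u x)%:E))%E).
- exact/measurable_EFinP.
- by move=> x _; rewrite /= lee_fin !normrM ler_pM// (le_trans (fM x))// ler_norm.
- exact: (@integrableZl _ _ _ m _ measurableT Mf _ iu).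
Qed.

(** Boundedness of [f] makes the positive and negative parts integrable, so the [fine] in [muV]
    discards nothing. *)
Lemma muV_E : ((ZV V * muV V f)%:E = \int[m]_x (f x * u x)%:E)%E.
Proof.
have mp : measurable_fun setT (fun x => Num.max (f x) 0) by exact: measurable_maxr.
have mn : measurable_fun setT (fun x => Num.max (- f x) 0).
  by apply: measurable_maxr => //; exact: measurableT_comp.
rewrite /muV !muV_intE//; last 2 first.
- by move=> x; rewrite le_max lexx orbT.
- by move=> x; rewrite le_max lexx orbT.
rewrite [RHS]integralE.
have -> : (\int[m]_x (Num.max (f x) 0 * u x)%:E = \int[m]_x ((fun x => (f x * u x)%:E) ^\+ x))%E.
  apply: eq_integral => x _; rewrite funeposE -EFin_max; congr EFin.
  by rewrite maxr_pMl ?expR_ge0// mul0r.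
have -> : (\int[m]_x (Num.max (- f x) 0 * u x)%:E = \int[m]_x ((fun x => (f x * u x)%:E) ^\- x))%E.
  apply: eq_integral => x _; rewrite funenegE -EFin_max; congr EFin.
  by rewrite maxr_pMl ?expR_ge0// mul0r mulNr.
have /fineK <- := integrable_pos_fin_num measurableT ifu.
have /fineK <- := integrable_neg_fin_num measurableT ifu.
rewrite -!EFinM/= -EFinB; congr EFin; field.
by rewrite gt_eqF.
Qed.

(** The density has total mass [ZV V], so [ZV V] times (mu f - a) is the integral of (f - a) u. *)
Lemma muV_dist a :
  ((ZV V * `|a - muV V f|)%:E <= \int[m]_x (`|f x - a| * u x)%:E)%E.
Proof.
have iau : m.-integrable setT (fun x => a%:E * (u x)%:E)%E by exact: (@integrableZl _ _ _ m _ measurableT a _ iu).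
have E : (\int[m]_x ((f x - a) * u x)%:E = (ZV V * muV V f - a * ZV V)%:E)%E.
  rewrite EFinB muV_E EFinM -integral_density -integralZl// -integralB//.
  by apply: eq_integral => x _; rewrite -EFinM -EFinB mulrBl.
have mfa : measurable_fun setT (fun x => ((f x - a) * u x)%:E).
  apply/measurable_EFinP; apply: measurable_funM => //.
  exact: measurable_funB.
have := le_abse_integral m measurableT mfa; rewrite E /= => h.
have -> : ZV V * `|a - muV V f| = `|ZV V * muV V f - a * ZV V|.
  by rewrite distrC -[X in X * _]gtr0_norm// -normrM mulrBr [a * _]mulrC.
apply: (le_trans h); rewrite le_eqVlt; apply/orP; left; apply/eqP.
by apply: eq_integral => x _; rewrite /= normrM [X in _ * X]ger0_norm// expR_ge0.
Qed.

(** Cauchy-Schwarz applied to [muV_dist] with |f - a| u split as (|f - a| w^(1/2)) (u / w^(1/2)). *)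
Lemma muV_dist_sqr (w : borelRV R d -> R) U a :
  measurable_fun setT w -> (forall x, 0 < w x) -> 0 < U ->
  (\int[m]_x (u x ^+ 2 / w x)%:E <= U%:E)%E ->
  (((ZV V * (a - muV V f)) ^+ 2)%:E <= U%:E * \int[m]_x ((f x - a) ^+ 2 * w x)%:E)%E.
Proof.
move=> mw w0 U0 hU; set G := (\int[m]_x _)%E.
have G0 : (0 <= G)%E.
  by apply: integral_ge0 => x _; rewrite lee_fin mulr_ge0 ?sqr_ge0// ltW.
pose A := ZV V * `|a - muV V f|.
have -> : (ZV V * (a - muV V f)) ^+ 2 = A ^+ 2.
  by rewrite /A !exprMn -normrX ger0_norm ?sqr_ge0.
have : 0 <= A by rewrite mulr_ge0// ltW.
(* The parameter [e] below divides by [A], so A = 0 is settled first. *)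
rewrite le_eqVlt => /predU1P[<-|A0].
  by rewrite expr0n/= mule_ge0// lee_fin ltW.
pose e := U / (2 * A).
have e0 : 0 < e by rewrite divr_gt0// mulr_gt0.
have mG : measurable_fun setT (fun x => ((f x - a) ^+ 2 * w x)%:E).
  apply/measurable_EFinP; apply: measurable_funM => //.
  by apply: measurable_funX; exact: measurable_funB.
have mU : measurable_fun setT (fun x => (u x ^+ 2 / w x)%:E).
  apply/measurable_EFinP; apply: measurable_funM => //; first exact: measurable_funX.
  rewrite [X in measurable_fun _ X](_ : _ = fun x => (w x `^ 1)^-1); last first.
    by apply/funext => x; rewrite powRr1// ltW.
  exact: (measurableT_comp (@measurable_inv_powR R 1) mw).
(* AM-GM: t v <= e t^2 w + v^2 / (4 e w), with e chosen so that the second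
   term integrates to at most A / 2 *)
have h : (A%:E <= e%:E * G + ((4 * e)^-1)%:E * U%:E)%E.
  apply: (le_trans (muV_dist a)).
  apply: (@le_trans _ _ (e%:E * G + ((4 * e)^-1)%:E * \int[m]_x (u x ^+ 2 / w x)%:E)%E).
    rewrite -ge0_integralZl//; last 2 first.
    - by move=> x _; rewrite lee_fin mulr_ge0 ?sqr_ge0// ltW.
    - by rewrite lee_fin ltW.
    rewrite -ge0_integralZl//; last 2 first.
    - by move=> x _; rewrite lee_fin divr_ge0 ?sqr_ge0// ltW.
    - by rewrite lee_fin invr_ge0 mulr_ge0// ltW.
    rewrite -ge0_integralD//; last 4 first.
    - by move=> x _; rewrite -EFinM lee_fin mulr_ge0 ?(ltW e0)// mulr_ge0 ?sqr_ge0// ltW.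
    - exact: measurable_funeM.
    - move=> x _; rewrite -EFinM lee_fin mulr_ge0//; last by rewrite divr_ge0 ?sqr_ge0// ltW.
      by rewrite invr_ge0 mulr_ge0// ltW.
    - exact: measurable_funeM.
    apply: ge0_le_integral => //.
    - by move=> x _; rewrite lee_fin mulr_ge0// expR_ge0.
    - apply/measurable_EFinP; apply: measurable_funM => //.
      by apply: measurableT_comp => //; exact: measurable_funB.
    - by apply: emeasurable_funD; exact: measurable_funeM.
    - move=> x _; rewrite -!EFinM -EFinD lee_fin.
      have ww := w0 x; rewrite -(real_normK (num_real (f x - a))).
      move: `|f x - a| (u x) (w x) ww => t v W W0; rewrite -subr_ge0.
      have -> : e * (t ^+ 2 * W) + (4 * e)^-1 * (v ^+ 2 / W) - t * v =
          (2 * e * t * W - v) ^+ 2 / (4 * e * W).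
        by field; rewrite !gt_eqF.
      by rewrite divr_ge0 ?sqr_ge0// (ltW (mulr_gt0 (mulr_gt0 _ e0) W0)).

  by rewrite leeD2l// lee_wpmul2l// lee_fin invr_ge0 mulr_ge0// ltW.
(* For finite G, A <= e G + A/2 multiplied by A reads A^2 <= U G / 2 + A^2 / 2. For infinite G the
   bound is trivial. *)
case: G G0 h => [g| |] //.
- rewrite -!EFinM -EFinD !lee_fin => g0.
  have -> : (4 * e)^-1 * U = A / 2 by rewrite /e; field; rewrite !gt_eqF.
  rewrite /e => h.
  have : A * A <= (U / (2 * A) * g + A / 2) * A by rewrite ler_wpM2r// ltW.
  have -> : (U / (2 * A) * g + A / 2) * A = U * g / 2 + A * A / 2.
    by field; rewrite gt_eqF.
  by rewrite expr2; lra.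
- by move=> _ _; rewrite gt0_muley ?lte_fin// leey.
Qed.

End weighted.
End mean.

(** * Trigonometric bounds and the class of smooth bounded functions *)

Section test_functions.
Variable R : realType.

Lemma is_derive_lipschitz (g dg : R -> R) (M a b : R) :
  (forall x : R, is_derive x 1 g (dg x)) -> (forall x, `|dg x| <= M) ->
  `|g b - g a| <= M * `|b - a|.
Proof.
move=> hg hM; wlog ab : a b / a <= b.
  by move=> h; have [/h//|/ltW/h] := leP a b; rewrite distrC [in X in _ <= _ * X]distrC.
have [|c _ ->] := @MVT_segment R g dg a b ab (fun x _ => hg x).
  by apply: derivable_within_continuous => x _; exact: ex_derive.
by rewrite normrM ler_wpM2r.
Qed.

Lemma cos_lipschitz (a b : R) : `|cos a - cos b| <= `|a - b|.
Proof.
rewrite -[leRHS]mul1r; apply: (@is_derive_lipschitz cos (fun x => - sin x)).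
by move=> x; rewrite normrN sin_max.
Qed.

Lemma sin_le_norm (a : R) : `|sin a| <= `|a|.
Proof.
have := @is_derive_lipschitz sin cos 1 0 a (@is_derive_sin R) (@cos_max R).
by rewrite sin0 !subr0 mul1r.
Qed.

Lemma cosB_sqr_le (a b : R) : (cos a - cos b) ^+ 2 <= 4 * Num.min 1 ((a - b) ^+ 2).
Proof.
rewrite minr_pMr// le_min; apply/andP; split.
  have := cos_max a; have := cos_max b; rewrite !ler_norml => /andP[b1 b2] /andP[a1 a2].
  by rewrite mulr1 -[leRHS]/(4%:R) (_ : 4 = 2 ^+ 2 :> R) ?ler_sqr_norm//; nra.
rewrite -[leLHS]real_normK ?num_real// -[(a - b) ^+ 2]real_normK ?num_real//.
have h := cos_lipschitz a b.
by have := lerXn2r 2 (normr_ge0 _) (normr_ge0 _) h; have := sqr_ge0 `|a - b|; lra.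
Qed.

(** The half-angle formula 1 - cos t = 2 sin^2(t/2) gives the quadratic bound that matches the
    numerator of [jump]. *)
Lemma subr1_cos_le (t : R) : `|cos t - 1| <= 2 * Num.min 1 (t ^+ 2).
Proof.
have c1 := cos_max t; have := c1; rewrite ler_norml => /andP[c2 c3].
rewrite ler0_norm ?subr_le0// minr_pMr// le_min; apply/andP; split; first by lra.
have E : 1 - cos t = 2 * sin (t / 2) ^+ 2.
  by rewrite [in LHS](splitr t) cosD -!expr2 cos2sin2; ring.
have : `|sin (t / 2)| ^+ 2 <= `|t / 2| ^+ 2.
  by rewrite lerXn2r ?nnegrE// sin_le_norm.
rewrite !real_normK ?num_real// opprB E => h.
have : (t / 2) ^+ 2 <= t ^+ 2 by have := sqr_ge0 t; rewrite expr_div_n; lra.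
by lra.
Qed.

Section lines.
Variable d : nat.
Implicit Types (f : 'rV[R]_d -> R) (x v : 'rV[R]_d).

(** The difference quotients agree as functions, so existence and value of directional derivatives
    transfer to and from one-variable derivatives. *)
Lemma line_quotient f x v (t : R) :
  (fun h => h^-1 *: (f (x + (h *: 1 + t) *: v) - f (x + t *: v))) =
  (fun h => h^-1 *: (f (h *: v + (x + t *: v)) - f (x + t *: v))).
Proof.
apply/funext => h; do 3 f_equal.
by rewrite [h *: 1]mulr1 scalerDl addrCA.
Qed.

Lemma is_derive_line f x v (t : R) : derivable f (x + t *: v) v ->
  is_derive t 1 (fun t => f (x + t *: v)) (derive f (x + t *: v) v).
Proof.
move=> df; split.
  by move: df; rewrite /derivable -line_quotient.
by rewrite /derive -line_quotient.
Qed.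

Lemma derive_line f x v a : is_derive (0 : R) 1 (fun t : R => f (x + t *: v)) a ->
  is_derive x v f a.
Proof.
move=> [h1 h2]; split.
  by move: h1; rewrite /derivable line_quotient scale0r addr0.
by move: h2; rewrite /derive line_quotient scale0r addr0.
Qed.

(** Only partial derivatives are given, so [x] is moved to [y] one coordinate at a time and the mean
    value theorem is applied on each segment. Continuity and measurability follow from this. *)
Lemma Cbinf_lipschitz f : Cbinf f ->
  exists2 M, 0 <= M & forall x y : 'rV[R]_d, `|f y - f x| <= M * \sum_i `|y ord0 i - x ord0 i|.
Proof.
move=> hf.
have /choice [M hM] : forall i : 'I_d, exists M : R, forall x, `|pderiv i f x| <= M.
  by move=> i; have [_ [M hM]] := hf [:: i]; exists M.
have df i x : derivable f x (delta_mx ord0 i) by have [h _] := hf [::]; exact: h.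
have M0 i : 0 <= M i by exact: le_trans (hM i 0).
exists (\sum_i M i); first exact: sumr_ge0.
move=> x y.
(* [z k] has the first k coordinates of [y] and the others of [x], so the path runs from z 0 = x to
   z d = y. *)
pose z (k : nat) : 'rV[R]_d := \row_i (if (i < k)%N then y ord0 i else x ord0 i).
have -> : f y - f x = \sum_(0 <= k < d) (f (z k.+1) - f (z k)).
  rewrite telescope_sumr//; congr (f _ - f _); apply/rowP => i; rewrite mxE ?ltn_ord//.
rewrite big_mkord (le_trans (ler_norm_sum _ _ _))// mulr_sumr; apply: ler_sum => k _.
have -> : z k.+1 = z k + (y ord0 k - x ord0 k) *: delta_mx ord0 k.
  apply/rowP => i; rewrite !mxE eqxx/= ltnS leq_eqVlt.
  have [->|ik] := eqVneq i k; first by rewrite eqxx ltnn/= mulr1; ring.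
  by rewrite -(inj_eq val_inj) in ik; rewrite (negbTE ik)/= mulr0 addr0.
have := @is_derive_lipschitz (fun t => f (z k + t *: delta_mx ord0 k))
   (fun t => pderiv k f (z k + t *: delta_mx ord0 k)) (M k) 0 (y ord0 k - x ord0 k)
   (fun t => is_derive_line (df k _)) (fun t => hM k _).
rewrite scale0r addr0 subr0 => /le_trans; apply.
by rewrite ler_wpM2r// (bigD1 k)//= lerDl sumr_ge0.
Qed.

Lemma Cbinf_continuous f : Cbinf f -> continuous f.
Proof.
move=> /Cbinf_lipschitz[M M0 hM] x.
apply/(@cvgrPdist_lt _ _ _ (nbhs x) (nbhs_filter x) f (f x)) => e e0.
(* The added 1 keeps the denominator positive when M = 0. *)
pose del := e / (M * d%:R + 1).
have D0 : 0 < M * d%:R + 1 by rewrite ltr_wpDl// mulr_ge0.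
have del0 : 0 < del by rewrite divr_gt0.
apply/nbhs_ballP; exists del => //= y [_ xy].
rewrite distrC (le_lt_trans (hM _ _))//.
apply: (@le_lt_trans _ _ (M * (d%:R * del))).
  rewrite ler_wpM2l// (@le_trans _ _ (\sum_(i < d) del))//.
    by apply: ler_sum => i _; have /ltW := xy ord0 i; rewrite /ball/= distrC.
  by rewrite sumr_const card_ord mulr_natl.
rewrite mulrA /del mulrCA gtr_pMr// ltr_pdivrMr// mul1r ltrDl//.
Qed.

Lemma Cbinf_measurable f : Cbinf f -> measurable_fun setT (f : borelRV R d -> R).
Proof. by move=> hf; apply: continuous_borel; exact: Cbinf_continuous. Qed.

Lemma Cbinf_bounded f : Cbinf f -> exists M, forall x, `|f x| <= M.
Proof. by move=> hf; have [_] := hf [::]. Qed.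

Variable j : 'I_d.

(** The span of the cosine and sine of x_j / n is stable under every partial derivative, so
    derivatives of all orders are handled by one induction. *)
Definition wave (a b n : R) (x : 'rV[R]_d) : R :=
  a * cos (x ord0 j / n) + b * sin (x ord0 j / n).

Lemma is_derive_wave a b n i x : is_derive x (delta_mx ord0 i) (wave a b n)
  (wave ((i == j)%:R * b / n) (- ((i == j)%:R * a / n)) n x).
Proof.
apply: derive_line.
pose c : R := (i == j)%:R; pose L (t : R) := (x ord0 j + t * c) / n.
have dL : is_derive (0 : R) 1 L (c / n).
  have -> : L = n^-1 \*: (cst (x ord0 j) + c \*: (id : R -> R)).
    apply/funext => t; rewrite /L /= fctE /=.
    rewrite -[c *: t]/(c * t) -[RHS]/(_ * _); ring.
  apply: is_derive_eq.
  by rewrite /GRing.scale/=; ring.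
have L0 : L 0 = x ord0 j / n by rewrite /L mul0r addr0.
have dc : is_derive (0 : R) 1 (cos \o L) (- sin (L 0) * (c / n)).
  exact: is_derive1_comp.
have ds : is_derive (0 : R) 1 (sin \o L) (cos (L 0) * (c / n)).
  exact: is_derive1_comp.
have -> : (fun t => wave a b n (x + t *: delta_mx ord0 i)) =
   a \*: (cos \o L) + b \*: (sin \o L).
  apply/funext => t; rewrite /wave /L !mxE eqxx/= eq_sym /c.
  by [].
apply: is_derive_eq.
rewrite L0 /wave /GRing.scale/= -/c; ring.
Qed.

Lemma dern_wave a b n s : exists a' b', dern s (wave a b n) = wave a' b' n.
Proof.
elim: s => [|i s [a' [b' IH]]] /=; first by exists a, b.
exists ((i == j)%:R * b' / n), (- ((i == j)%:R * a' / n)).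
rewrite IH; apply/funext => x; rewrite /pderiv.
by have [_] := is_derive_wave a' b' n i x.
Qed.

Lemma Cbinf_wave a b n : Cbinf (wave a b n).
Proof.
move=> s; have [a' [b' ->]] := dern_wave a b n s; split.
  by move=> i x; have [] := is_derive_wave a' b' n i x.
exists (`|a'| + `|b'|) => x; rewrite (le_trans (ler_normD _ _))// !normrM.
by rewrite lerD// ler_piMr// ?cos_max ?sin_max.
Qed.

End lines.
End test_functions.

(** * Decay of the density and the inner integral of the form *)

Section energy.
Variable R : realType.

(** The limit hypothesis with eps = 1 controls the tail, and the global bound [M] controls the
    remaining ball. *)
Lemma density_decay d (V : 'rV[R]_d -> R) (s M : R) : 0 <= s ->
  (forall x, expR (- V x) <= M) ->
  (forall eps : R, 0 < eps -> exists r0 : R, forall x : 'rV[R]_d,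
      r0 <= enorm x ->
      sup [set expR (- V z) | z in [set z | enorm x <= enorm z]]
        * enorm x `^ s <= eps) ->
  exists2 K, 0 < K & forall x, expR (- V x) <= K * ((1 + enorm x) `^ s)^-1.
Proof.
move=> s0 hM /(_ 1 ltr01)[r0 hr0].
have M0 : 0 < M by apply: lt_le_trans (hM 0); rewrite expR_gt0.
(* Beyond radius 1, 1 + |x| <= 2|x|, which is the source of 2^s. *)
pose r1 := Num.max r0 1.
have r11 : 1 <= r1 by rewrite le_max lexx orbT.
have p1 : 0 < (1 + r1) `^ s by rewrite powR_gt0//; lra.
exists (M * (1 + r1) `^ s + 2 `^ s).
  by rewrite addr_gt0 ?(mulr_gt0 M0 p1)// powR_gt0.
move=> x; have e0 := enorm_ge0 x.
have q0 : 0 < (1 + enorm x) `^ s by rewrite powR_gt0//; lra.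
rewrite ler_pdivlMr// mulrC; have [xr|xr] := leP (enorm x) r1.
  apply: (@le_trans _ _ (M * (1 + r1) `^ s)); last by rewrite lerDl powR_ge0.
  rewrite mulrC ler_pM ?expR_ge0 ?powR_ge0//.
  by rewrite ge0_ler_powR ?nnegrE//; lra.
have xr0 : r0 <= enorm x by apply: le_trans (ltW xr); rewrite le_max lexx.
have x1 : 1 <= enorm x by apply: le_trans (ltW xr).
apply: (@le_trans _ _ (2 `^ s)); last by rewrite lerDr mulr_ge0// ltW.
apply: (@le_trans _ _ (2 `^ s * (enorm x `^ s * expR (- V x)))).
  rewrite mulrA -powRM ?(le_trans ler01 x1)//.
  by rewrite ler_wpM2r ?expR_ge0// ge0_ler_powR ?nnegrE//; lra.
rewrite ger_pMr ?powR_gt0// mulrC (le_trans _ (hr0 x xr0))//.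
(* A real-valued [sup] dominates its set only if that set is bounded above; [M] bounds it. *)
rewrite ler_wpM2r ?powR_ge0//; apply: ub_le_sup; last by exists x => //=.
by exists M => _ [z _ <-].
Qed.

Section form.
Variables (d : nat) (m : {sigma_finite_measure set (borelRV R d) -> \bar R}).
Hypothesis Lm : lebesgue_like m.
Variable V : 'rV[R]_d -> R.
Hypothesis mV : measurable_fun setT (V : borelRV R d -> R).
Variable f : borelRV R d -> R.
Hypothesis mf : measurable_fun setT f.
Variable alpha : R.

Definition jump_energy (x : borelRV R d) : \bar R :=
  (\int[m]_y ((f y - f x) ^+ 2 / (enorm (y - x)) `^ (d%:R + alpha))%:E)%E.

Let quotient (z : borelRV R d * borelRV R d) : \bar R :=
  ((f z.2 - f z.1) ^+ 2 / (enorm (z.2 - z.1)) `^ (d%:R + alpha))%:E.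

Let quotient_ge0 z : (0 <= quotient z)%E.
Proof. by rewrite lee_fin divr_ge0 ?sqr_ge0 ?powR_ge0. Qed.

Let measurable_quotient : measurable_fun setT quotient.
Proof.
apply/measurable_EFinP; apply: measurable_funM.
  apply: measurable_funX; apply: measurable_funB.
    exact: (measurableT_comp mf measurable_snd).
  exact: (measurableT_comp mf measurable_fst).
exact: (measurableT_comp (@measurable_inv_powR R _) (@measurable_enorm_sub R d)).
Qed.

Lemma measurable_jump_energy : measurable_fun setT jump_energy.
Proof.
have h := @measurable_fun_fubini_tonelli_F _ _ _ _ _ m quotient measurable_quotient quotient_ge0.
exact: h.
Qed.

Lemma jump_energy_ge0 x : (0 <= jump_energy x)%E.
Proof. by apply: integral_ge0 => y _; exact: (quotient_ge0 (x, y)). Qed.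

(** Both [iint] become integrals against [m]; for the outer one, Tonelli's theorem supplies
    measurability of the inner integral in [x]. *)
Lemma DaVE : DaV alpha V f =
  (\int[m]_x (jump_energy x * (expR (- V x))%:E) * ((ZV V)^-1)%:E)%E.
Proof.
rewrite /DaV /muV_int; congr (_ * _)%E.
rewrite -(Lm.1 (fun x => jump_energy x * (expR (- V x))%:E))%E; last 2 first.
- apply: emeasurable_funM; first exact: measurable_jump_energy.
  by apply/measurable_EFinP; exact: (measurable_density mV).
- by move=> x; rewrite mule_ge0 ?jump_energy_ge0// lee_fin expR_ge0.
congr iint; apply/funext => x; congr (_ * _)%E.
have mq : measurable_fun setT (fun y : borelRV R d => quotient (x : borelRV R d, y)).
  have h := measurableT_comp measurable_quotient (pair1_measurable (x : borelRV R d)).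
  exact: h.
exact: (Lm.1 (fun y : borelRV R d => quotient (x, y)) mq (fun y => quotient_ge0 (x, y))).
Qed.

End form.
End energy.

(** * The weighted Poincare inequality *)

Section poincare.
Variable R : realType.

(* The hypothesis [y = x -> a = b] covers the junk value of the right-hand side
   at [y = x]. *)
Lemma sqrB_weight_le d (s a b : R) (x y : 'rV[R]_d) : 0 <= s -> cube 0 1 x ->
  (y = x -> a = b) ->
  (a - b) ^+ 2 * ((1 + enorm y) `^ s)^-1 <=
  d%:R `^ s * ((a - b) ^+ 2 / enorm (y - x) `^ s).
Proof.
move=> s0 Qx ab; have e0 := enorm_ge0 (y - x).
have y0 := enorm_ge0 y.
have [e1|e1] := eqVneq (enorm (y - x)) 0.
  rewrite ab ?subrr ?expr0n/= ?mul0r ?mulr0//.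
  apply/rowP => i; apply/eqP; rewrite -subr_eq0 -normr_le0 -e1.
  by rewrite (le_trans _ (coord_le_enorm _ i))// !mxE.
have ep : 0 < enorm (y - x) by rewrite lt_def e1.
rewrite mulrCA ler_wpM2l ?sqr_ge0//.
rewrite ler_pdivlMr ?powR_gt0// mulrC ler_pdivrMr ?powR_gt0//; last by lra.
rewrite -powRM ?ler0n//; last by lra.
rewrite ge0_ler_powR ?nnegrE ?mulr_ge0//; first by lra.
rewrite (le_trans (enorm_le_sum _))//.
rewrite (@le_trans _ _ (\sum_(i < d) (1 + enorm y)))//.
  apply: ler_sum => i _; rewrite !mxE (le_trans (ler_normB _ _))// addrC lerD//.
    by have := Qx i; rewrite !mxE add0r ler_norml => /andP[h1 h2]; apply/andP; split; lra.
  exact: coord_le_enorm.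
by rewrite sumr_const card_ord mulr_natl.
Qed.

Section form.
Variables (d : nat) (m : {sigma_finite_measure set (borelRV R d) -> \bar R}).
Hypothesis Lm : lebesgue_like m.
Variable V : 'rV[R]_d -> R.
Hypothesis mV : measurable_fun setT (V : borelRV R d -> R).
Hypothesis Vfin : (iint (fun x => (expR (- V x))%:E) < +oo)%E.
Variable c : R.
Hypothesis c0 : 0 < c.
Hypothesis cu : forall x, cube 0 1 x -> c <= expR (- V x).
Variables alpha alpha0 K : R.
Hypothesis alpha02 : 0 < alpha < 2.
Hypothesis alpha0P : 0 < alpha0 < alpha / 2.
Hypothesis K0 : 0 < K.
Hypothesis uK : forall x, expR (- V x) <= K * ((1 + enorm x) `^ (d%:R + (alpha - alpha0)))^-1.

Let u (x : borelRV R d) := expR (- V x).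
Let w (x : borelRV R d) := ((1 + enorm x) `^ (d%:R + alpha))^-1.

Let mu : measurable_fun setT u.
Proof. exact: (measurable_density mV). Qed.

Let mw : measurable_fun setT w.
Proof.
apply: (measurableT_comp (@measurable_inv_powR R (d%:R + alpha))).
by apply: measurable_funD => //; exact: measurable_enorm.
Qed.

Let w0 x : 0 < w x.
Proof. by rewrite invr_gt0 powR_gt0// ltr_wpDr ?enorm_ge0. Qed.

Let Z0 : 0 < ZV V.
Proof. exact: (ZV_gt0 Lm mV Vfin c0 cu). Qed.

Let s0 : 0 <= d%:R + alpha.
Proof. by have := ler0n R d; move/andP: alpha02 => [h _] _; rewrite addr_ge0// ltW. Qed.

Lemma density_sqr_integral :
  exists2 U, 0 < U & (\int[m]_x (u x ^+ 2 / w x)%:E <= U%:E)%E.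
Proof.
have b02 : 0 < alpha - 2 * alpha0 < 2.
  by move/andP: alpha02 => [? ?]; move/andP: alpha0P => [? ?]; apply/andP; split; lra.
have [W W0 hW] := weight_integral Lm b02.
exists (K ^+ 2 * W); first by rewrite mulr_gt0 ?exprn_gt0.
rewrite EFinM (le_trans _ (lee_wpmul2l _ hW)) ?lee_fin ?sqr_ge0//.
have mv : measurable_fun setT (fun x : borelRV R d =>
    (((1 + enorm x) `^ (d%:R + (alpha - 2 * alpha0)))^-1)%:E).
  apply/measurable_EFinP; apply: (measurableT_comp (@measurable_inv_powR R _)).
  by apply: measurable_funD => //; exact: measurable_enorm.
rewrite -ge0_integralZl//; last 2 first.
- by move=> x _; rewrite lee_fin invr_ge0 powR_ge0.
- by rewrite lee_fin sqr_ge0.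
apply: ge0_le_integral => //.
- by move=> x _; rewrite lee_fin divr_ge0 ?sqr_ge0// ltW.
- apply/measurable_EFinP; apply: measurable_funM; first exact: measurable_funX.
  rewrite [X in measurable_fun _ X](_ : _ = fun x : borelRV R d => (1 + enorm x) `^ (d%:R + alpha)).
    apply: (measurableT_comp (@measurable_powR R _)).
    by apply: measurable_funD => //; exact: measurable_enorm.
  by apply/funext => x; rewrite /w invrK.
- exact: measurable_funeM.
move=> x _; rewrite -EFinM lee_fin /w invrK.
have t0 : 0 < 1 + enorm x by rewrite ltr_wpDr ?enorm_ge0.
have := uK x; rewrite -/(u x).
have : 0 <= u x by exact: expR_ge0.
move: (u x) => v v0; move: (1 + enorm x) t0 => t t0 hv.
have q0 : 0 < t `^ (d%:R + alpha) by exact: powR_gt0.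
have p0 : 0 < t `^ (d%:R + (alpha - alpha0)) by exact: powR_gt0.
have r0 : 0 < t `^ (d%:R + (alpha - 2 * alpha0)) by exact: powR_gt0.
(* Twice the decay exponent of u is the exponent of w plus d + alpha - 2 alpha0, the integrable
   exponent that remains. *)
have E : t `^ (d%:R + (alpha - alpha0)) * t `^ (d%:R + (alpha - alpha0)) =
   t `^ (d%:R + alpha) * t `^ (d%:R + (alpha - 2 * alpha0)).
  rewrite -!powRD ?(gt_eqF t0) ?implybT//; congr (_ `^ _); ring.
have h2 : v ^+ 2 <= (K * (t `^ (d%:R + (alpha - alpha0)))^-1) ^+ 2.
  by rewrite lerXn2r ?nnegrE// mulr_ge0 ?invr_ge0 ?ltW.
rewrite (le_trans (ler_wpM2r (ltW q0) h2))// exprMn exprVn expr2 -expr2 [X in X^-1]expr2 E.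
rewrite le_eqVlt; apply/orP; left; apply/eqP.
by field; rewrite !gt_eqF.
Qed.

Lemma weighted_poincare : exists2 C2, 0 < C2 &
  forall f : 'rV[R]_d -> R, measurable_fun setT (f : borelRV R d -> R) ->
   (exists M, forall x, `|f x| <= M) ->
   (muV_int V (fun x => ((f x - muV V f) ^+ 2 * omega alpha V x)%:E)
          <= C2%:E * DaV alpha V f)%E.
Proof.
have [W W0 hW] := weight_integral Lm alpha02.
have [U U0 hU] := density_sqr_integral.
(* From (f - mm)^2 <= 2 (f - a)^2 + 2 (a - mm)^2: the first term gives 2, the second W times the
   bound U G / Z^2 of [muV_dist_sqr]. *)
pose K1 := 2 + 2 * W * U / ZV V ^+ 2.
have K10 : 0 < K1 by rewrite addr_gt0 ?divr_gt0 ?mulr_gt0 ?exprn_gt0.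
(* d^(d + alpha) compares w(y) with the jump kernel, and 1/c inserts the density on the unit
   cube. *)
pose K2 := d%:R `^ (d%:R + alpha) / c.
have K20 : 0 <= K2 by rewrite divr_ge0 ?powR_ge0// ltW.
(* [K2] is only known to be nonnegative; adding 1 makes the constant positive. *)
exists (K1 * K2 + 1); first by rewrite ltr_wpDl// mulr_ge0// ltW.
move=> f mf [Mf fM].
set mm := muV V f.
pose je := jump_energy m f alpha.
have mje : measurable_fun setT je by exact: measurable_jump_energy.
have je0 x : (0 <= je x)%E by exact: jump_energy_ge0.
have mjeu : measurable_fun setT (fun x => je x * (u x)%:E)%E.
  by apply: emeasurable_funM => //; exact/measurable_EFinP.
have jeu0 x : (0 <= je x * (u x)%:E)%E by rewrite mule_ge0// lee_fin expR_ge0.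
pose g a (y : borelRV R d) := (f y - a) ^+ 2 * w y.
have mg a : measurable_fun setT (fun y => (g a y)%:E).
  apply/measurable_EFinP; apply: measurable_funM => //.
  by apply: measurable_funX; exact: measurable_funB.
have g0 a y : (0 <= (g a y)%:E)%E by rewrite lee_fin mulr_ge0 ?sqr_ge0// ltW.
(* [ZV V] times the left-hand side, because omega e^-V = w. *)
pose L := (\int[m]_y (g mm y)%:E)%E.
have L0 : (0 <= L)%E by exact: integral_ge0.
pose G a := (\int[m]_y (g a y)%:E)%E.
have G0 a : (0 <= G a)%E by exact: integral_ge0.
have LG a : (L <= K1%:E * G a)%E.
  have h := muV_dist_sqr Lm mV Vfin Z0 mf fM a mw w0 U0 hU.
  rewrite -/mm -/(G a) in h.
  apply: (@le_trans _ _ (\int[m]_y (2%:E * (g a y)%:E + (2 * (a - mm) ^+ 2)%:E * (w y)%:E))%E).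
    apply: ge0_le_integral => //.
    - apply: emeasurable_funD; apply: measurable_funeM => //.
      exact/measurable_EFinP.
    - move=> y _; rewrite -!EFinM -EFinD lee_fin /g mulrA -mulrDl ler_wpM2r ?(ltW (w0 y))//.
      (* With p = f y - a and q = a - mm, 2 p^2 + 2 q^2 - (p + q)^2 = (p - q)^2. *)
      by rewrite -subr_ge0; have := sqr_ge0 (f y - a - (a - mm)); nra.
  rewrite ge0_integralD//; last 4 first.
  - by move=> y _; rewrite mule_ge0.
  - exact: measurable_funeM.
  - by move=> y _; rewrite -EFinM lee_fin mulr_ge0 ?(ltW (w0 y))// mulr_ge0 ?sqr_ge0.
  - by apply: measurable_funeM; exact/measurable_EFinP.
  rewrite ge0_integralZl// ge0_integralZl//; last 3 first.
  - exact/measurable_EFinP.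
  - by move=> y _; rewrite lee_fin ltW.
  - by rewrite lee_fin mulr_ge0 ?sqr_ge0.
  have t0 : 0 <= 2 * W * U / ZV V ^+ 2 by rewrite divr_ge0 ?sqr_ge0 ?mulr_ge0 ?ltW.
  have -> : (K1%:E * G a = 2%:E * G a + (2 * W * U / ZV V ^+ 2)%:E * G a)%E.
    by rewrite /K1 EFinD; apply: ge0_muleDl; rewrite lee_fin.
  apply: leeD2l.
  apply: (@le_trans _ _ ((2 * (a - mm) ^+ 2)%:E * W%:E)%E).
    by rewrite lee_wpmul2l// lee_fin mulr_ge0 ?sqr_ge0.
  have -> : ((2 * (a - mm) ^+ 2)%:E * W%:E =
      (2 * W / ZV V ^+ 2)%:E * ((ZV V * (a - mm)) ^+ 2)%:E)%E.
    by rewrite -!EFinM; congr EFin; field; rewrite gt_eqF.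
  have -> : 2 * W * U / ZV V ^+ 2 = 2 * W / ZV V ^+ 2 * U by ring.
  rewrite [(_ * U)%:E]EFinM -muleA lee_wpmul2l// lee_fin divr_ge0 ?sqr_ge0// mulr_ge0// ltW//.
have Gje x : cube 0 1 x -> (G (f x) <= K2%:E * (je x * (u x)%:E))%E.
  move=> Qx.
  apply: (@le_trans _ _ ((d%:R `^ (d%:R + alpha))%:E * je x)%E).
    have mq : measurable_fun setT (fun y : borelRV R d =>
      ((f y - f x) ^+ 2 / enorm (y - x) `^ (d%:R + alpha))%:E).
      apply/measurable_EFinP; apply: measurable_funM.
        by apply: measurable_funX; exact: measurable_funB.
      exact: (measurableT_comp (@measurable_inv_powR R _) (measurable_enorm_subr x)).
    have q0 y : (0 <= ((f y - f x) ^+ 2 / enorm (y - x) `^ (d%:R + alpha))%:E)%E.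
      by rewrite lee_fin divr_ge0 ?sqr_ge0 ?powR_ge0.
    rewrite /je /jump_energy -ge0_integralZl ?lee_fin ?powR_ge0//.
    apply: ge0_le_integral => //; first exact: measurable_funeM.
    move=> y _; rewrite -EFinM lee_fin; apply: sqrB_weight_le => //.
    by move=> ->.
  rewrite /K2 EFinM -muleA; move: (je x) (je0 x) => J J0.
  rewrite lee_wpmul2l ?lee_fin ?powR_ge0//.
  rewrite muleCA -[leLHS]mule1 lee_wpmul2l// -EFinM lee_fin.
  by rewrite mulrC ler_pdivlMr// mul1r cu.
have mQ : measurable (cube 0 1 : set (borelRV R d)) by exact: measurable_cube.
have LI : (L <= (K1 * K2)%:E * \int[m]_x (je x * (u x)%:E))%E.
  (* [L] is constant in [x] and the cube has measure one, so [L] is its own integral over the cube,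
     where [LG] with a = f x and then [Gje] apply. *)
  clearbody je G; have -> : L = (\int[m]_(x in cube 0 1) L)%E.
    have -> : (\int[m]_(x in cube 0 1) L = L * m (cube 0 1))%E by rewrite integral_cst.
    by rewrite Lm.2// expr1n mule1.
  rewrite -ge0_integralZl//; last by rewrite lee_fin mulr_ge0// ltW.
  apply: (@le_trans _ _ (\int[m]_(x in cube 0 1) ((K1 * K2)%:E * (je x * (u x)%:E)))%E).
    apply: ge0_le_integral => //.
    - by apply: measurable_funTS; exact: measurable_funeM.
    - move=> x Qx; apply: (le_trans (LG (f x))).
      rewrite EFinM -muleA lee_wpmul2l ?lee_fin ?(ltW K10)//; exact: Gje.
  apply: ge0_subset_integral => //; first exact: measurable_funeM.
  by move=> x _; rewrite mule_ge0// lee_fin mulr_ge0// ltW.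
have momega : measurable_fun setT (fun x : borelRV R d => omega alpha V x).
  apply: measurable_funM; last exact: mw.
  exact: (measurableT_comp (@measurable_expR R) mV).
rewrite (muV_intE Lm mV (F := fun x => (f x - mm) ^+ 2 * omega alpha V x)); last 2 first.
- apply: measurable_funM => //.
  by apply: measurable_funX; exact: measurable_funB.
- by move=> x; rewrite mulr_ge0 ?sqr_ge0// divr_ge0 ?expR_ge0 ?powR_ge0.
have -> : (\int[m]_x ((f x - mm) ^+ 2 * omega alpha V x * expR (- V x))%:E = L)%E.
  apply: eq_integral => x _; congr EFin; rewrite /g /omega -mulrA; congr (_ * _).
  by rewrite mulrAC -expRD subrr expR0 mul1r.
rewrite (DaVE Lm mV mf) muleA; apply: lee_wpmul2r.
  by rewrite lee_fin invr_ge0 ltW.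
apply: (le_trans LI); apply: lee_wpmul2r; first by apply: integral_ge0.
by rewrite lee_fin lerDl.
Qed.

End form.
End poincare.

(** * Optimality of the weight *)

Section optimality.
Variable R : realType.

Section form.
Variables (d : nat) (m : {sigma_finite_measure set (borelRV R d) -> \bar R}).
Hypothesis Lm : lebesgue_like m.
Variable V : 'rV[R]_d -> R.
Hypothesis mV : measurable_fun setT (V : borelRV R d -> R).
Hypothesis Vfin : (iint (fun x => (expR (- V x))%:E) < +oo)%E.
Hypothesis Z0 : 0 < ZV V.
Variable j : 'I_d.

Let u (x : borelRV R d) := expR (- V x).

Let mu : measurable_fun setT u.
Proof. exact: (measurable_density mV). Qed.

Notation cosw n := (wave j 1 0 n).

Lemma cosE n (x : 'rV[R]_d) : cosw n x = cos (x ord0 j / n).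
Proof. by rewrite /wave mul1r mul0r addr0. Qed.

Lemma cosw_le1 n (x : 'rV[R]_d) : `|cosw n x| <= 1.
Proof. by rewrite cosE cos_max. Qed.

Let mcos n : measurable_fun setT (cosw n : borelRV R d -> R).
Proof. by apply: Cbinf_measurable; exact: Cbinf_wave. Qed.

Let mjump b n x : measurable_fun setT (fun y : borelRV R d => (jump d b n (enorm (y - x)))%:E).
Proof.
apply/measurable_EFinP.
exact: (measurableT_comp (@measurable_jump R d b n) (measurable_enorm_subr x)).
Qed.

Lemma coord_sqr_le n (x : 'rV[R]_d) : 0 < n ->
  Num.min 1 ((x ord0 j / n) ^+ 2) <= Num.min 1 ((enorm x / n) ^+ 2).
Proof.
move=> n0; rewrite le_min !ge_min lexx /=; apply/orP; right.
rewrite -[(x ord0 j / n) ^+ 2]real_normK ?num_real//.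
rewrite lerXn2r ?nnegrE ?divr_ge0 ?enorm_ge0 ?(ltW n0)//.
by rewrite normrM [`|n^-1|]gtr0_norm ?invr_gt0// ler_pM2r ?invr_gt0// coord_le_enorm.
Qed.

(** The squared increment of the cosine is at most 4 min(1, |y-x|^2/n^2), so the inner integral is
    O(n^-alpha) uniformly in [x], and mu_V has mass one. *)
Lemma cosw_energy alpha : 0 < alpha < 2 ->
  exists2 C, 0 < C & forall n, 0 < n ->
    (DaV alpha V (cosw n) <= (C / n `^ alpha)%:E)%E.
Proof.
move=> al; have [C C0 hC] := jump_integral Lm al.
exists (4 * C); first by rewrite mulr_gt0.
move=> n n0; have C'0 : 0 <= 4 * C / n `^ alpha by rewrite divr_ge0 ?powR_ge0 ?mulr_ge0 ?ltW.
rewrite (DaVE Lm mV (mcos n)).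
have je x : (jump_energy m (cosw n) alpha x <= (4 * C / n `^ alpha)%:E)%E.
  apply: (@le_trans _ _ (4%:E * \int[m]_y (jump d alpha n (enorm (y - x)))%:E)%E); last first.
    by rewrite -mulrA EFinM lee_wpmul2l// hC.
  rewrite -ge0_integralZl//; last by move=> y _; rewrite lee_fin jump_ge0.
  apply: ge0_le_integral => //.
  - by move=> y _; rewrite lee_fin divr_ge0 ?sqr_ge0 ?powR_ge0.
  - apply/measurable_EFinP; apply: measurable_funM.
      by apply: measurable_funX; exact: measurable_funB.
    exact: (measurableT_comp (@measurable_inv_powR R _) (measurable_enorm_subr x)).
  - exact: measurable_funeM.
  - move=> y _; rewrite -EFinM lee_fin /jump mulrA ler_wpM2r ?invr_ge0 ?powR_ge0//.
    rewrite !cosE (le_trans (cosB_sqr_le _ _))// ler_wpM2l//.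
    have := coord_sqr_le (y - x) n0; rewrite !mxE.
    by rewrite -mulrBl.
have je0 := jump_energy_ge0 m (cosw n) alpha.
have mje := measurable_jump_energy m (mcos n) alpha.
apply: (@le_trans _ _ ((4 * C / n `^ alpha * ZV V)%:E * ((ZV V)^-1)%:E)%E).
  apply: lee_wpmul2r; first by rewrite lee_fin invr_ge0 ltW.
  rewrite EFinM -(integral_density Lm mV Vfin) -ge0_integralZl//; last exact/measurable_EFinP.
  move: (jump_energy m (cosw n) alpha) je je0 mje => J je je0 mje.
  apply: ge0_le_integral => //.
  - by move=> x _; rewrite mule_ge0// lee_fin expR_ge0.
  - by apply: emeasurable_funM => //; exact/measurable_EFinP.
  - by apply: measurable_funeM; exact/measurable_EFinP.
  - by move=> x _; apply: lee_wpmul2r; [rewrite lee_fin expR_ge0|exact: je].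
by rewrite -EFinM mulfK ?gt_eqF.
Qed.

(** [muV_dist] with a = 1: the bound on 1 - cos and the decay of [u] together put the integrand
    below 2 K times [jump]. *)
Lemma cosw_mean b K : 0 < b < 2 -> 0 < K ->
  (forall x, u x <= K * ((1 + enorm x) `^ (d%:R + b))^-1) ->
  exists2 C, 0 < C & forall n, 0 < n ->
    `|1 - muV V (cosw n)| <= C / n `^ b.
Proof.
move=> hb K0 uK; have [C C0 hC] := jump_integral Lm hb.
have s0 : 0 <= d%:R + b by move/andP: hb => [? _]; rewrite addr_ge0// ltW.
exists (2 * K * C / ZV V); first by rewrite divr_gt0 ?mulr_gt0.
move=> n n0; have nb : 0 < n `^ b by exact: powR_gt0.
have := muV_dist Lm mV Vfin Z0 (mcos n) (cosw_le1 n) 1 => h.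
have h2 : ((ZV V * `|1 - muV V (cosw n)|)%:E <= ((2 * K)%:E * (C / n `^ b)%:E))%E.
  apply: (le_trans h).
  apply: (@le_trans _ _ ((2 * K)%:E * \int[m]_y (jump d b n (enorm (y - 0)))%:E)%E); last first.
    by rewrite lee_wpmul2l// ?hC// lee_fin mulr_ge0// ltW.
  rewrite -ge0_integralZl//; last 2 first.
  - by move=> y _; rewrite lee_fin jump_ge0.
  - by rewrite lee_fin mulr_ge0// ltW.
  apply: ge0_le_integral => //.
  - apply/measurable_EFinP; apply: measurable_funM => //.
    by apply: measurableT_comp => //; exact: measurable_funB.
  - exact: measurable_funeM.
  move=> x _; rewrite -EFinM lee_fin cosE subr0.
  have c1 := subr1_cos_le (x ord0 j / n).
  have c2 := coord_sqr_le x n0.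
  have e0 := enorm_ge0 x.
  have m0 : 0 <= Num.min 1 ((x ord0 j / n) ^+ 2) by rewrite le_min ler01 sqr_ge0.
  (* Replacing 1 + |x| by |x| in the decay bound requires |x| > 0; at |x| = 0 the cosine is 1 and
     both sides vanish. *)
  have [e1|e1] := eqVneq (enorm x) 0.
    move: c1 c2; rewrite /jump e1 mul0r expr0n/= (_ : Num.min 1 0 = 0); last exact/min_idPr.
    move=> c1 c2; have -> : `|cos (x ord0 j / n) - 1| = 0.
      by apply/eqP; rewrite eq_le normr_ge0 andbT; lra.
    by rewrite !mul0r mulr0.
  have ep : 0 < enorm x by rewrite lt_def e1.
  rewrite /jump.
  have -> : 2 * K * (Num.min 1 ((enorm x / n) ^+ 2) / enorm x `^ (d%:R + b)) =
    2 * Num.min 1 ((enorm x / n) ^+ 2) * (K * (enorm x `^ (d%:R + b))^-1) by ring.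
  rewrite ler_pM ?expR_ge0//.
    by rewrite (le_trans c1)// ler_wpM2l.
  rewrite (le_trans (uK x))// ler_wpM2l ?(ltW K0)// ler_powR_inv// lerDr//.
move: h2; rewrite -EFinM lee_fin => h2.
have -> : 2 * K * C / ZV V / n `^ b = 2 * K * (C / n `^ b) / ZV V by field; rewrite !gt_eqF.
by rewrite ler_pdivlMr// mulrC.
Qed.

(** On this cube x_j / n lies in [pi/2, pi/2 + 1], where the cosine is nonpositive. As 1 <= pi/2 <
    2, x_j is at least n and every coordinate is at most 3n in absolute value. *)
Lemma cos_cube n (x : 'rV[R]_d) : 1 <= n ->
  cube (\row_i (if i == j then n * (pi / 2) else 0)) n x ->
  [/\ cosw n x <= 0, n <= enorm x & 1 + enorm x <= (3 * d%:R + 1) * n].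
Proof.
move=> n1 Qx; have n0 : 0 < n by exact: lt_le_trans n1.
have p1 : 1 <= pi / 2 :> R by exact: pihalf_ge1.
have p2 : pi / 2 < 2 :> R by exact: pihalf_lt2.
have := Qx j; rewrite mxE eqxx => /andP[x1 x2].
have x3 : n <= x ord0 j by nra.
split.
- rewrite cosE -[x ord0 j / n](subrK (pi / 2)) cosDpihalf oppr_le0.
  apply: sin_ge0_pi; apply/andP; split.
    by rewrite subr_ge0 ler_pdivlMr// mulrC.
  rewrite lerBlDr ler_pdivrMr//; nra.
- by rewrite (le_trans x3)// (le_trans (ler_norm _))// coord_le_enorm.
- rewrite mulrDl mul1r addrC lerD//.
  rewrite (le_trans (enorm_le_sum _))//.
  rewrite (@le_trans _ _ (\sum_(i < d) (3 * n)))//.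
    apply: ler_sum => i _; have := Qx i; rewrite mxE ler_norml.
    by case: eqP => _ /andP[y1 y2]; apply/andP; split; nra.
  by rewrite sumr_const card_ord mulrAC mulr_natr.
Qed.

(** Both sides scale like n^-alpha, and only the lower bound carries the factor [M], so one
    sufficiently large [n] contradicts [C]. *)
Lemma weight_optimal alpha b K (omega_star : 'rV[R]_d -> R) :
  0 < alpha < 2 -> 0 < b < 2 -> 0 < K ->
  (forall x, u x <= K * ((1 + enorm x) `^ (d%:R + b))^-1) ->
  borel_fun omega_star -> (forall x, 0 < omega_star x) ->
  (forall M : R, exists r0 : R, forall x : 'rV[R]_d,
     r0 <= enorm x -> M <= omega_star x / omega alpha V x) ->
  ~ (exists C : R, 0 < C /\
       forall f : 'rV[R]_d -> R, Cbinf f ->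
         (muV_int V (fun x => ((f x - muV V f) ^+ 2 * omega_star x)%:E)
            <= C%:E * DaV alpha V f)%E).
Proof.
move=> al hb K0 uK bo o0 ho [C [C0 hC]].
have mo := borel_fun_measurable bo.
have [E E0 hE] := cosw_energy al.
have [T T0 hT] := cosw_mean hb K0 uK.
have s0 : 0 <= d%:R + alpha by move/andP: al => [? _]; rewrite addr_ge0// ltW.
have b0 : 0 < b by case/andP: hb.
pose D3 := (3 * d%:R + 1) `^ (d%:R + alpha) : R.
have d30 : 0 < 3 * d%:R + 1 :> R by rewrite ltr_wpDl// mulr_ge0.
have D30 : 0 < D3 by exact: powR_gt0.
(* Chosen so that, after the factors 1/4 and 1/D3, the lower bound keeps the constant C E Z + 1
   against C E Z above. *)
pose M := (4 * C * E * ZV V + 4) * D3.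
have M0 : 0 < M by rewrite mulr_gt0// ltr_wpDl// !mulr_ge0// ltW.
have [r0 hr0] := ho M.
(* The three bounds serve [cos_cube], the ratio of the weights, and T / n^b <= 1/2. *)
pose n := Num.max 1 (Num.max r0 ((2 * T) `^ b^-1)).
have n1 : 1 <= n by rewrite le_max lexx.
have nr0 : r0 <= n by rewrite !le_max lexx orbT.
have n0 : 0 < n by exact: lt_le_trans n1.
have nb : 2 * T <= n `^ b.
  have -> : 2 * T = ((2 * T) `^ b^-1) `^ b.
    by rewrite -powRrM mulVf ?gt_eqF// powRr1// mulr_ge0// ltW.
  by rewrite ge0_ler_powR ?nnegrE ?powR_ge0 ?(ltW n0) ?(ltW b0)// !le_max lexx !orbT.
set f := cosw n; set mm := muV V f.
have mm2 : 1 / 2 <= mm.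
  have := hT n n0; rewrite -/mm => h.
  have : T / n `^ b <= 1 / 2 by rewrite ler_pdivrMr ?powR_gt0//; lra.
  by move: h; rewrite ler_norml => /andP[h1 h2] h3; lra.
pose Q : set (borelRV R d) := cube (\row_i (if i == j then n * (pi / 2) else 0)) n.
have mQ : measurable Q by exact: measurable_cube.
(* 1/4 comes from f <= 0 and mm >= 1/2, [M] from the ratio of the weights, and the power from w on
   the cube. *)
pose kap := 1 / 4 * (M * (((3 * d%:R + 1) * n) `^ (d%:R + alpha))^-1).
have kap0 : 0 <= kap.
  by rewrite mulr_ge0// mulr_ge0 ?(ltW M0)// invr_ge0 powR_ge0.
pose F (x : borelRV R d) := (f x - mm) ^+ 2 * omega_star x.
have F0 x : 0 <= F x by rewrite mulr_ge0 ?sqr_ge0// ltW.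
have mF : measurable_fun setT F.
  apply: measurable_funM => //; apply: measurable_funX; apply: measurable_funB => //.
  exact: mcos.
have mFu : measurable_fun setT (fun x => (F x * u x)%:E).
  by apply/measurable_EFinP; exact: measurable_funM.
have kF x : Q x -> kap <= F x * u x.
  move=> /(cos_cube n1)[q1 q2 q3].
  have e1 : 0 < 1 + enorm x by rewrite ltr_wpDr ?enorm_ge0.
  have om : 0 < omega alpha V x by rewrite divr_gt0 ?expR_gt0 ?powR_gt0.
  have := hr0 x (le_trans nr0 q2); rewrite ler_pdivlMr// => h.
  rewrite /F -mulrA ler_pM//.
  - by rewrite mulr_ge0 ?(ltW M0)// invr_ge0 powR_ge0.
  - by rewrite -/f in q1; nra.
  - apply: (@le_trans _ _ (M * omega alpha V x * u x)); last by rewrite ler_wpM2r ?expR_ge0.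
    rewrite -mulrA ler_wpM2l ?(ltW M0)//.
    have -> : omega alpha V x * u x = ((1 + enorm x) `^ (d%:R + alpha))^-1.
      by rewrite /omega /u mulrAC -expRD subrr expR0 mul1r.
    by rewrite ler_powR_inv.
have lower : ((kap * n ^+ d)%:E <= \int[m]_x (F x * u x)%:E)%E.
  apply: (@le_trans _ _ (\int[m]_(x in Q) kap%:E)%E).
    have -> : (\int[m]_(x in Q) kap%:E = kap%:E * m Q)%E by rewrite integral_cst.
    by rewrite Lm.2 ?(ltW n0).
  apply: (@le_trans _ _ (\int[m]_(x in Q) (F x * u x)%:E)%E).
    apply: ge0_le_integral => //; first exact: measurable_funTS.
  apply: ge0_subset_integral => // x _.
  by rewrite lee_fin mulr_ge0// expR_ge0.
have := hC f (Cbinf_wave j 1 0 n); rewrite -/mm (muV_intE Lm mV mF F0) => hf.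
have : ((kap * n ^+ d)%:E * ((ZV V)^-1)%:E <= C%:E * (E / n `^ alpha)%:E)%E.
  apply: (@le_trans _ _ (C%:E * DaV alpha V f)%E); last first.
    by rewrite lee_wpmul2l ?hE// lee_fin ltW.
  apply: le_trans hf; apply: lee_wpmul2r => //.
  by rewrite lee_fin invr_ge0 ltW.
rewrite -!EFinM lee_fin ler_pdivrMr// /kap powRM ?(ltW d30) ?(ltW n0)// -/D3 powR_natD//.
have na : 0 < n `^ alpha by exact: powR_gt0.
have nd : 0 < n ^+ d by exact: exprn_gt0.
(* The volume n^d of the cube cancels the n^d in the weight, leaving n^-alpha as on the energy
   side. *)
have -> : 1 / 4 * (M * (D3 * (n ^+ d * n `^ alpha))^-1) * n ^+ d =
  (C * E * ZV V + 1) / n `^ alpha.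
  by rewrite /M; field; rewrite !gt_eqF.
have -> : C * (E / n `^ alpha) * ZV V = (C * E * ZV V) / n `^ alpha by ring.
by rewrite ler_pM2r ?invr_gt0//; lra.
Qed.

End form.
End optimality.

(** * The inequality together with its optimality *)

Theorem theorem1p4 (R : realType) (d : nat) (alpha alpha0 : R)
  (V : 'rV[R]_d -> R) :
  (1 <= d)%N ->
  admissible_V V ->
  0 < alpha < 2 ->
  0 < alpha0 < alpha / 2 ->
  (* limsup_{|x|->oo} (sup_{|z|>=|x|} e^{-V(z)}) |x|^{d+alpha-alpha0} = 0
     (the quantity is nonnegative) *)
  (forall eps : R, 0 < eps -> exists r0 : R, forall x : 'rV[R]_d,
      r0 <= enorm x ->
      sup [set expR (- V z) | z in [set z | enorm x <= enorm z]]
        * enorm x `^ (d%:R + alpha - alpha0) <= eps) ->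
  (exists C2 : R, 0 < C2 /\
     forall f : 'rV[R]_d -> R, Cbinf f ->
       (muV_int V (fun x => ((f x - muV V f) ^+ 2 * omega alpha V x)%:E)
          <= C2%:E * DaV alpha V f)%E)
  /\
  (forall omega_star : 'rV[R]_d -> R,
     borel_fun omega_star ->
     (forall x, 0 < omega_star x) ->
     (* liminf_{|x|->oo} omega_star/omega = +oo *)
     (forall M : R, exists r0 : R, forall x : 'rV[R]_d,
        r0 <= enorm x -> M <= omega_star x / omega alpha V x) ->
     ~ (exists C : R, 0 < C /\
          forall f : 'rV[R]_d -> R, Cbinf f ->
            (muV_int V (fun x => ((f x - muV V f) ^+ 2 * omega_star x)%:E)
               <= C%:E * DaV alpha V f)%E)).
Proof.
move=> d1 [bV [Vloc [[M hM] Vfin]]] al al0 hlim.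
have [m Lm] := lebesgue_likeP R d.
have mV := borel_fun_measurable bV.
have hb : 0 < alpha - alpha0 < 2 by move/andP: al => [? ?]; move/andP: al0 => [? ?]; apply/andP; split; lra.
have [K K0 uK] : exists2 K, 0 < K & forall x : 'rV[R]_d,
    expR (- V x) <= K * ((1 + enorm x) `^ (d%:R + (alpha - alpha0)))^-1.
  rewrite addrA; apply: density_decay hM hlim.
  by move/andP: hb => [? _]; rewrite -addrA addr_ge0// ltW.
(* The unit cube lies in the ball of radius d, where local boundedness gives the lower bound exp(-N)
   for the density. *)
have [N hN] := Vloc d%:R.
have cu (x : 'rV[R]_d) : cube 0 1 x -> expR (- N) <= expR (- V x).
  move=> Qx; rewrite ler_expR lerN2 (le_trans (ler_norm _))// hN//.
  rewrite (le_trans (enorm_le_sum x))// (@le_trans _ _ (\sum_(i < d) 1))//.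
    apply: ler_sum => i _; have := Qx i; rewrite !mxE add0r ler_norml => /andP[h1 h2].
    by apply/andP; split; lra.
  by rewrite sumr_const card_ord.
have Z0 := ZV_gt0 Lm mV Vfin (expR_gt0 _) cu.
split.
  have [C2 C20 h] := weighted_poincare Lm mV Vfin (expR_gt0 _) cu al al0 K0 uK.
  exists C2; split=> // f hf; apply: h; first exact: Cbinf_measurable.
  exact: Cbinf_bounded.
(* Coordinate 0 exists because d >= 1; the test functions oscillate along it. *)
move=> om; exact: (weight_optimal Lm mV Vfin Z0 (Ordinal d1) al hb K0 uK).
Qed.
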